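(* Let $(f,\xi)$ be an equiaffine pair representing a line congruence, let $p$ be a point of the parameter domain with $\delta(p)>0$, and let $\lambda_i$ ($i\in\{1,2\}$) be an eigenvalue of the shape operator with $\lambda_i(p)\neq0$. Put $Z_i=f(p)+\lambda_i(p)^{-1}\xi(p)$. Then $p$ is an $A_2$ point of the support function $\rho(\cdot,Z_i)$ if and only if $p$ is not an $i$-ridge point.
   Context: A line congruence is given by a pair $(f,\xi)$, where $f:U\to\mathbb{R}^3$ is a smooth immersion of an open set $U\subset\mathbb{R}^2$ and $\xi:U\to\mathbb{R}^3$ is smooth and transversal to $f$; the lines are $t\mapsto f(u,v)+t\xi(u,v)$. Write $D_X\xi=-f_*(SX)+\tau(X)\xi$ and $D_Xf_*Y=f_*(\nabla_XY)+h(X,Y)\xi$, with shape operator $S=\begin{pmatrix}a&b\\ c&d\end{pmatrix}$, $1$-form $\tau$ and symmetric bilinear form $h$. The pair is equiaffine if $\tau=0$ and $h$ is non-degenerate. Let $\delta=(a-d)^2+4bc$; where $\delta>0$, $S$ has two distinct real eigenvalues $\lambda_1,\lambda_2$, smooth functions on $\{\delta>0\}$, whose eigenvectors are called principal directions. A point $p$ with $\delta(p)>0$, $\lambda_i(p)\ne0$ is an $i$-ridge point if $F_i=f+\lambda_i^{-1}\xi$ is not an immersion at $p$; equivalently $d\lambda_i(X)-\lambda_i\tau(X)=0$ at $p$ for $X$ an eigenvector of $S$ for $\lambda_i$. For an equiaffine pair, the co-normal $\nu$ is defined by $\nu\cdot f_u=\nu\cdot f_v=0$, $\nu\cdot\xi=1$,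 and the support function is $\rho(u,v,Z)=\nu(u,v)\cdot(Z-f(u,v))$, $Z\in\mathbb{R}^3$. The point $p$ is an $A_k$ point of $\rho(\cdot,Z)$ if $p$ is a critical point of $(u,v)\mapsto\rho(u,v,Z)$ and the germ at $p$ is, up to an additive constant and a smooth change of coordinates in the source, $\pm x^{k+1}\pm y^2$. *)

(* Defs.v *)
From HB Require Import structures.
From mathcomp Require Import all_boot all_order all_algebra.
From mathcomp Require Import all_classical all_reals all_analysis.
Import Order.TTheory GRing.Theory Num.Theory.
Import numFieldNormedType.Exports.
Set Implicit Arguments.
Unset Strict Implicit.
Unset Printing Implicit Defensive.
Local Open Scope classical_set_scope.
Local Open Scope ring_scope.

(* Points and tangent vectors of the parameter plane are row vectors ['rV_2],
   points of 3-space are row vectors ['rV_3]; a 2 x 2 matrix acts on a tangent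
   vector [X] as [X *m S], the convention of [eigenvalue] and [jacobian]. *)

Definition dot (R : realType) (n : nat) (x y : 'rV[R]_n) : R :=
  \sum_(j < n) x 0 j * y 0 j.

(* Values of [g] outside the open set [U] are irrelevant: only differentials
   at points of [U] are taken. *)
Fixpoint Ck_on (R : realType) (W : normedModType R) (k : nat)
    (U : set 'rV[R]_2) (g : 'rV[R]_2 -> W) : Prop :=
  match k with
  | 0 => forall q, U q -> {for q, continuous g}
  | k'.+1 => (forall q, U q -> differentiable g q) /\
             (forall v : 'rV[R]_2, Ck_on k' U (fun q => 'D_v g q))
  end.

Definition smooth_on (R : realType) (W : normedModType R)
    (U : set 'rV[R]_2) (g : 'rV[R]_2 -> W) : Prop :=
  forall k : nat, Ck_on k U g.

Definition immersion_at (R : realType) (g : 'rV[R]_2 -> 'rV[R]_3)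
    (q : 'rV[R]_2) : Prop :=
  differentiable g q /\ injective ('d g q).

Definition line_congruence (R : realType) (U : set 'rV[R]_2)
    (f xi : 'rV[R]_2 -> 'rV[R]_3) : Prop :=
  [/\ open U, smooth_on U f, smooth_on U xi,
      forall q, U q -> immersion_at f q
    & forall q, U q -> ~ range ('d f q) (xi q)].

(* D_X xi = - f_*(SX) + tau(X) xi *)
Definition weingarten_eq (R : realType) (U : set 'rV[R]_2)
    (f xi : 'rV[R]_2 -> 'rV[R]_3) (S : 'rV[R]_2 -> 'M[R]_2)
    (tau : 'rV[R]_2 -> 'rV[R]_2 -> R) : Prop :=
  forall q X, U q ->
    'D_X xi q = - 'd f q (X *m S q) + tau q X *: xi q.

(* D_X f_*Y = f_*(nabla_X Y) + h(X, Y) xi, for smooth vector fields X, Y.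
   As f_u, f_v, xi form a basis, this equation and the previous one determine
   S, tau, nabla and h on U; they force tau to be linear and h to be bilinear
   and symmetric, so these properties are not repeated. *)
Definition gauss_eq (R : realType) (U : set 'rV[R]_2)
    (f xi : 'rV[R]_2 -> 'rV[R]_3)
    (nabla : ('rV[R]_2 -> 'rV[R]_2) -> ('rV[R]_2 -> 'rV[R]_2) ->
             'rV[R]_2 -> 'rV[R]_2)
    (h : 'rV[R]_2 -> 'rV[R]_2 -> 'rV[R]_2 -> R) : Prop :=
  forall X Y : 'rV[R]_2 -> 'rV[R]_2, smooth_on U X -> smooth_on U Y ->
  forall q, U q ->
    'D_(X q) (fun z => 'd f z (Y z)) q =
      'd f q (nabla X Y q) + h q (X q) (Y q) *: xi q.

Definition equiaffine (R : realType) (U : set 'rV[R]_2)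
    (tau : 'rV[R]_2 -> 'rV[R]_2 -> R)
    (h : 'rV[R]_2 -> 'rV[R]_2 -> 'rV[R]_2 -> R) : Prop :=
  (forall q X, U q -> tau q X = 0) /\
  (forall q X, U q -> (forall Y, h q X Y = 0) -> X = 0).

(* (a - d)^2 + 4 b c for the matrix (a b; c d) *)
Definition delta (R : realType) (S : 'M[R]_2) : R :=
  (S 0 0 - S 1 1) ^+ 2 + 4 * S 0 1 * S 1 0.

(* [lam] is a smooth labelling of the two eigenvalues of S where delta > 0. *)
Definition principal_curvatures (R : realType) (U : set 'rV[R]_2)
    (S : 'rV[R]_2 -> 'M[R]_2) (lam : 'I_2 -> 'rV[R]_2 -> R) : Prop :=
  (forall q, U q -> 0 < delta (S q) ->
     (forall i, eigenvalue (S q) (lam i q)) /\ lam 0 q != lam 1 q) /\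
  (forall i, smooth_on [set q | U q /\ 0 < delta (S q)] (lam i)).

Definition focal (R : realType) (f xi : 'rV[R]_2 -> 'rV[R]_3)
    (l : 'rV[R]_2 -> R) (q : 'rV[R]_2) : 'rV[R]_3 :=
  f q + (l q)^-1 *: xi q.

Definition ridge_point (R : realType) (U : set 'rV[R]_2)
    (f xi : 'rV[R]_2 -> 'rV[R]_3) (S : 'rV[R]_2 -> 'M[R]_2)
    (lam : 'I_2 -> 'rV[R]_2 -> R) (i : 'I_2) (p : 'rV[R]_2) : Prop :=
  [/\ U p, 0 < delta (S p), lam i p != 0
    & ~ immersion_at (focal f xi (lam i)) p].

Definition conormal (R : realType) (U : set 'rV[R]_2)
    (f xi nu : 'rV[R]_2 -> 'rV[R]_3) : Prop :=
  forall q, U q ->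
    (forall j : 'I_2, dot (nu q) ('D_(delta_mx 0 j) f q) = 0) /\
    dot (nu q) (xi q) = 1.

Definition support_fun (R : realType) (f nu : 'rV[R]_2 -> 'rV[R]_3)
    (q : 'rV[R]_2) (Z : 'rV[R]_3) : R :=
  dot (nu q) (Z - f q).

Definition diffeomorphism (R : realType) (V W : set 'rV[R]_2)
    (phi psi : 'rV[R]_2 -> 'rV[R]_2) : Prop :=
  [/\ open V, open W, smooth_on V phi, smooth_on W psi
    & (forall x, V x -> W (phi x) /\ psi (phi x) = x) /\
      (forall y, W y -> V (psi y) /\ phi (psi y) = y)].

Definition critical_point (R : realType) (g : 'rV[R]_2 -> R)
    (p : 'rV[R]_2) : Prop :=
  differentiable g p /\ forall X, 'd g p X = 0.

(* [phi] = (x, y) is the change of coordinates, centred at [p]; [s] and [t]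
   are the two signs, chosen independently. *)
Definition Ak_point (R : realType) (k : nat) (g : 'rV[R]_2 -> R)
    (p : 'rV[R]_2) : Prop :=
  critical_point g p /\
  exists (s t : bool) (c : R) (V W : set 'rV[R]_2)
         (phi psi : 'rV[R]_2 -> 'rV[R]_2),
    [/\ diffeomorphism V W phi psi, V p, phi p = 0
      & forall q, V q ->
          g q = c + (-1) ^+ s * phi q 0 0 ^+ k.+1
                  + (-1) ^+ t * phi q 0 1 ^+ 2].

(* Main.v *)
(* Put [Z = f p + xi p / l p], where [l] is the chosen eigenvalue and [e] is its
   eigenvector at [p], and let [H X Y = nu . D_X D_Y f] (the affine form [h])
   and [K X Y = D_X nu . D_Y xi = H X (S Y)]. The derivative of the support
   function along [X] is [D_X nu . (Z - f)], so [p] is critical and the Hessian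
   there is [H - K / l], which has rank one and kernel [e]. Differentiating
   [det (K - l H) = 0] along [e] gives [D_e (K e e) = D_e l * H e e + l * D_e (H e e)],
   whence the third derivative of the support function along [e] is
   [- D_e l * H e e / l] with [H e e != 0].

   A critical point of [G] whose Hessian has rank one and kernel [e] is an [A_2]
   point exactly when the third derivative along [e] does not vanish. For the
   sufficiency, Taylor quotients in coordinates [x] (along [e]) and [y] give
   [G = G p + x^3 a + x^2 y b + y^2 c] with [a], [b], [c] smooth and [a], [c]
   nonzero, that is,
   [G = G p + x^3 (a - x b^2 / (4 c)) + c (y + x^2 b / (2 c))^2], and
   the inverse function theorem turns the cube and the square into coordinates.

   Finally [d(f + xi / l)(X) = f_* (X - S X / l) - (D_X l / l^2) xi], which is
   injective at [p] exactly when [D_e l != 0]. *)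

Require Import Defs.
From HB Require Import structures.
From mathcomp Require Import all_boot all_order all_algebra.
From mathcomp Require Import all_classical all_reals all_analysis.
From mathcomp Require Import ring lra.
Import Order.TTheory GRing.Theory Num.Theory.
Import numFieldNormedType.Exports.
Set Implicit Arguments.
Unset Strict Implicit.
Unset Printing Implicit Defensive.
Local Open Scope classical_set_scope.
Local Open Scope ring_scope.

(** * Smooth maps on open subsets of the plane *)

Section differentiability.
Context {R : realType}.

(** [Ck_on] speaks of derivatives along constant directions, so a regularity claim is an induction
    on the order in which the derivative is rewritten through maps already controlled. For an
    inverse map this is the bootstrap by the inverse Jacobian. For a quotient by a power of a
    coordinate, whose value on the zero line of that coordinate is prescribed by hand, it works
    because the derivative of a Taylor quotient is a combination of Taylor quotients of other
    functions and orders. The regularity of [nu] and [S] has to be recovered by Cramer's rule: [nu]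
    from the frame formed by the partial derivatives of [f] and [xi], [S] from the matrices of [H]
    and [K]. Continuity of [S] makes [0 < delta (S q)] an open condition, so the determinant
    identity holds near [p] and may be differentiated, in a fixed basis of eigenvectors at [p] and
    without a smooth field of eigenvectors. For the necessity, let [u], [y] be the coordinates of
    the normal form. The kernel direction [e] of the Hessian is tangent to [y = 0], and the third
    derivative along it is, up to sign, six times the cube of the derivative of [u]. *)

Lemma eps_is_diff (V W : normedModType R) (g : V -> W) (q : V)
    (L : {linear V -> W}) : continuous L ->
  (forall e, 0 < e ->
     \forall z \near q, `|g z - g q - L (z - q)| <= e * `|z - q|) ->
  is_diff q g L.
Proof.
move=> cL H.
have E : g \o shift q = cst (g q) + L +o_ 0 id.
  apply/eqaddoP => e e0; have := H e e0.
  rewrite (near_shift 0 q) subr0; apply: filterS => h /=.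
  by rewrite addrK opprD addrA.
have D := diff_unique cL E.
apply: DiffDef => //; apply/diff_locallyP; split; first by rewrite D.
by rewrite D.
Qed.

Lemma diff_eps (V W : normedModType R) (g : V -> W) (q : V) :
  differentiable g q -> forall e, 0 < e ->
  \forall z \near q, `|g z - g q - 'd g q (z - q)| <= e * `|z - q|.
Proof.
move=> /diff_locallyP[_ /eqaddoP E] e e0.
have : \forall h \near (0 : V), `|g (h + q) - g q - 'd g q h| <= e * `|h|.
  by apply: filterS (E e e0) => h /=; rewrite opprD addrA.
rewrite (near_shift q 0) sub0r; apply: filterS => h /=.
by rewrite subrK.
Qed.

Lemma near_eq_differentiable {V W : normedModType R} {g g' : V -> W} {q : V} :
  (\forall z \near q, g z = g' z) -> differentiable g q -> differentiable g' q.
Proof.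
move=> E dg; suff /(@ex_diff _ _ _ _ _ _ _) : is_diff q g' ('d g q) by [].
apply: eps_is_diff => [|e e0]; first exact: diff_continuous.
near=> z; rewrite -(near E z)// -(nbhs_singleton E).
by near: z; exact: diff_eps.
Unshelve. all: by end_near. Qed.

Lemma derivable_line (W : normedModType R) (n : nat) (g : 'rV[R]_n -> W)
    (q v : 'rV[R]_n) (t : R) :
  derivable g (q + t *: v) v ->
  is_derive t 1 (fun s => g (q + s *: v)) ('D_v g (q + t *: v)).
Proof.
have E : (fun h : R => h^-1 *: (((fun s => g (q + s *: v)) \o shift t) (h *: 1)
    - g (q + t *: v))) =
  (fun h : R => h^-1 *: ((g \o shift (q + t *: v)) (h *: v) - g (q + t *: v))).
  apply/funext => h /=; congr (_ *: (g _ - _)).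
  by rewrite [h *: 1]mulr1 scalerDl addrCA.
by move=> dg; apply: DeriveDef; rewrite /derivable /derive /= E.
Qed.

Lemma mvt_line (n : nat) (g : 'rV[R]_n -> R) (q v : 'rV[R]_n) :
  (forall t : R, 0 <= t <= 1 -> derivable g (q + t *: v) v) ->
  exists2 t : R, 0 < t < 1 & g (q + v) - g q = 'D_v g (q + t *: v).
Proof.
move=> dg.
have d1 (t : R) : 0 <= t <= 1 ->
    is_derive t 1 (fun s => g (q + s *: v)) ('D_v g (q + t *: v)).
  by move=> /dg; apply: derivable_line.
have [| |t] := @MVT R (fun s => g (q + s *: v))
    (fun t => 'D_v g (q + t *: v)) 0 1 ltr01.
- by move=> t; rewrite in_itv/= => /andP[t0 t1]; apply: d1; rewrite !ltW.
- apply: derivable_within_continuous => t; rewrite in_itv/= => t01.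
  by have [] := d1 t t01.
- by rewrite in_itv/= subr0 mulr1 scale0r addr0 scale1r; exists t.
Qed.

End differentiability.

(** * Vector-valued maps of class [Ck_on]: locality and linear operations *)

Section Ck_on_vector.
Context {R : realType}.
Implicit Type U : set 'rV[R]_2.

Lemma Ck_onW {W : normedModType R} {k U} {g : 'rV[R]_2 -> W} :
  Ck_on k.+1 U g -> Ck_on k U g.
Proof.
elim: k g => [|k IH] g [dg Dg].
  by move=> q /dg; exact: differentiable_continuous.
by split=> // v; exact: IH.
Qed.

Lemma smooth_onP {W : normedModType R} {U} {g : 'rV[R]_2 -> W} :
  smooth_on U g <-> (forall q, U q -> differentiable g q) /\
                    (forall v, smooth_on U (fun q => 'D_v g q)).
Proof.
split=> [sg|[dg sg] k].
  split; first by have [] := sg 1.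
  by move=> v k; have [_ Dg] := sg k.+1; exact: Dg.
by apply: Ck_onW; split=> // v; exact: sg.
Qed.

Lemma smooth_diff {W : normedModType R} {U} {g : 'rV[R]_2 -> W} {q} :
  smooth_on U g -> U q -> differentiable g q.
Proof. by move=> /smooth_onP[dg _]; exact: dg. Qed.

Lemma smooth_derivable {W : normedModType R} {U} {g : 'rV[R]_2 -> W} {q} v :
  smooth_on U g -> U q -> derivable g q v.
Proof. by move=> sg Uq; apply: diff_derivable; exact: smooth_diff sg Uq. Qed.

Lemma smooth_cont {W : normedModType R} {U} {g : 'rV[R]_2 -> W} {q} :
  smooth_on U g -> U q -> {for q, continuous g}.
Proof. by move=> sg Uq; exact: (sg 0). Qed.

Lemma smooth_derive {W : normedModType R} {U} {g : 'rV[R]_2 -> W} v :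
  smooth_on U g -> smooth_on U (fun q => 'D_v g q).
Proof. by move=> /smooth_onP[]. Qed.

Lemma Ck_onS {W : normedModType R} {k U V} {g : 'rV[R]_2 -> W} :
  V `<=` U -> Ck_on k U g -> Ck_on k V g.
Proof.
move=> VU; elim: k g => [|k IH] g; first by move=> cg q /VU; exact: cg.
by move=> [dg Dg]; split=> [q /VU /dg //|v]; exact: IH (Dg v).
Qed.

Lemma smooth_onS {W : normedModType R} {U V} {g : 'rV[R]_2 -> W} :
  V `<=` U -> smooth_on U g -> smooth_on V g.
Proof. by move=> VU sg k; exact: Ck_onS (sg k). Qed.

Lemma near_open {U} {q : 'rV[R]_2} {P : 'rV[R]_2 -> Prop} :
  open U -> U q -> (forall z, U z -> P z) -> \forall z \near q, P z.
Proof. by move=> oU Uq UP; apply: (filterS UP); apply: open_nbhs_nbhs; split. Qed.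

Lemma derive_eq_on {W : normedModType R} {U} {g g' : 'rV[R]_2 -> W} {q} v :
  open U -> (forall z, U z -> g z = g' z) -> U q -> 'D_v g q = 'D_v g' q.
Proof. by move=> oU E Uq; apply: near_eq_derive; exact: (near_open oU Uq E).
Qed.

(** Openness of [U] turns equality on [U] into equality near each of its points, so the derivatives
    agree on [U] as well. The closure properties use this to replace a derivative by its formula. *)
Lemma Ck_on_eq {W : normedModType R} {k U} {g g' : 'rV[R]_2 -> W} :
  open U -> (forall q, U q -> g q = g' q) -> Ck_on k U g -> Ck_on k U g'.
Proof.
move=> oU; elim: k g g' => [|k IH] g g' E.
  move=> cg q Uq; have cgq := cg q Uq; rewrite /prop_for /continuous_at -E//.
  apply: cvg_trans cgq; apply: near_eq_cvg.
    exact: (nbhs_filter q).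
  by apply: filterS (near_open oU Uq E) => z /= ->.
move=> [dg Dg]; split=> [q Uq|v].
  exact: near_eq_differentiable (near_open oU Uq E) (dg q Uq).
by apply: IH (Dg v) => q Uq; exact: derive_eq_on oU E Uq.
Qed.

Lemma smooth_on_eq {W : normedModType R} {U} {g g' : 'rV[R]_2 -> W} :
  open U -> (forall q, U q -> g q = g' q) -> smooth_on U g -> smooth_on U g'.
Proof. by move=> oU E sg k; exact: Ck_on_eq oU E (sg k). Qed.

Lemma Ck_on_cst {W : normedModType R} {k U} (a : W) :
  Ck_on k U (fun _ => a).
Proof.
elim: k a => [|k IH] a; first by move=> q _; exact: cst_continuous.
split=> [q _|v]; first exact: differentiable_cst.
rewrite [X in Ck_on _ _ X](_ : _ = fun _ => 0); first exact: IH.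
by apply/funext => q; rewrite derive_cst.
Qed.

Lemma Ck_on_linear {W : normedModType R} {k U}
    (L : {linear 'rV[R]_2 -> W}) : continuous L -> Ck_on k U L.
Proof.
move=> cL; case: k => [|k]; first by move=> q _; exact: cL.
split=> [q _|v]; first exact: linear_differentiable.
rewrite [X in Ck_on _ _ X](_ : _ = fun _ => L v); first exact: Ck_on_cst.
apply/funext => q; rewrite deriveE; last exact: linear_differentiable.
by rewrite diff_lin.
Qed.

Lemma Ck_onD {W : normedModType R} {k U} {f g : 'rV[R]_2 -> W} : open U ->
  Ck_on k U f -> Ck_on k U g -> Ck_on k U (fun q => f q + g q).
Proof.
move=> oU; elim: k f g => [|k IH] f g.
  by move=> cf cg q Uq; apply: continuousD; [exact: cf|exact: cg].
move=> [df Df] [dg Dg]; split=> [q Uq|v].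
  by apply: differentiableD; [exact: df|exact: dg].
apply: (Ck_on_eq oU _ (IH _ _ (Df v) (Dg v))) => q Uq.
by rewrite -deriveD//; apply: diff_derivable; [exact: df|exact: dg].
Qed.

Lemma Ck_onZ {W : normedModType R} {k U} (a : R) {f : 'rV[R]_2 -> W} : open U ->
  Ck_on k U f -> Ck_on k U (fun q => a *: f q).
Proof.
move=> oU; elim: k f => [|k IH] f.
  by move=> cf q Uq; apply: continuousZr; exact: cf.
move=> [df Df]; split=> [q Uq|v].
  by apply: differentiableZ; exact: df.
apply: (Ck_on_eq oU _ (IH _ (Df v))) => q Uq.
by rewrite -deriveZ//; apply: diff_derivable; exact: df.
Qed.

End Ck_on_vector.

(** * Scalar functions of class [Ck_on]: products, real powers, inverses *)

Section Ck_on_scalar.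
Context {R : realType}.
Implicit Types (U : set 'rV[R]_2) (f g : 'rV[R]_2 -> R).

Lemma Ck_onN {k U f} : open U ->
  Ck_on k U f -> Ck_on k U (fun q => - f q).
Proof.
move=> oU /(Ck_onZ (- 1) oU); apply: Ck_on_eq => // q _.
by rewrite [_ *: _]mulN1r.
Qed.

Lemma Ck_onB {k U f g} : open U ->
  Ck_on k U f -> Ck_on k U g -> Ck_on k U (fun q => f q - g q).
Proof. by move=> oU cf /(Ck_onN oU); exact: Ck_onD. Qed.

Lemma Ck_onM {k U f g} : open U ->
  Ck_on k U f -> Ck_on k U g -> Ck_on k U (fun q => f q * g q).
Proof.
move=> oU; elim: k f g => [|k IH] f g.
  by move=> cf cg q Uq; apply: continuousM; [exact: cf|exact: cg].
move=> cf cg; have [df Df] := cf; have [dg Dg] := cg; split=> [q Uq|v].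
  by apply: differentiableM; [exact: df|exact: dg].
apply: (Ck_on_eq oU _ (Ck_onD oU (IH _ _ (Ck_onW cf) (Dg v))
  (IH _ _ (Ck_onW cg) (Df v)))) => q Uq.
by rewrite -[LHS]deriveM//; apply: diff_derivable; [exact: df|exact: dg].
Qed.

Lemma Ck_on_sum {k U} {I : Type} (r : seq I) (P : pred I)
    (F : I -> 'rV[R]_2 -> R) : open U ->
  (forall i, Ck_on k U (F i)) -> Ck_on k U (fun q => \sum_(i <- r | P i) F i q).
Proof.
move=> oU cF; elim: r => [|i r IH].
  by apply: (Ck_on_eq oU _ (Ck_on_cst 0)) => q _; rewrite big_nil.
apply: (Ck_on_eq oU (g := fun q => (if P i then F i q else 0) +
   \sum_(i <- r | P i) F i q)) => [q _|].
  by rewrite big_cons; case: ifP => _; rewrite ?add0r.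
by apply: Ck_onD => //; case: (P i) => //; exact: Ck_on_cst.
Qed.

Lemma Ck_on_prod {k U} {I : Type} (r : seq I) (P : pred I)
    (F : I -> 'rV[R]_2 -> R) : open U ->
  (forall i, Ck_on k U (F i)) -> Ck_on k U (fun q => \prod_(i <- r | P i) F i q).
Proof.
move=> oU cF; elim: r => [|i r IH].
  by apply: (Ck_on_eq oU _ (Ck_on_cst (1 : R))) => q _; rewrite big_nil.
apply: (Ck_on_eq oU (g := fun q => (if P i then F i q else 1) *
   \prod_(i <- r | P i) F i q)) => [q _|].
  by rewrite big_cons; case: ifP => _; rewrite ?mul1r.
by apply: Ck_onM => //; case: (P i) => //; exact: Ck_on_cst.
Qed.

Lemma derive_powR {U f} (a : R) {q} v : open U ->
  (forall z, U z -> 0 < f z) -> U q -> differentiable f q ->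
  differentiable (fun z => f z `^ a) q /\
  'D_v (fun z => f z `^ a) q = a * f q `^ (a - 1) * 'D_v f q.
Proof.
move=> oU f0 Uq df.
have [d1 E1] := is_derive1_powR a (f0 q Uq).
have d2 : differentiable (@powR R ^~ a) (f q) by apply/derivable1_diffP.
have dc : differentiable (fun z => f z `^ a) q.
  by apply: (@differentiable_comp _ _ _ _ f (@powR R ^~ a)).
split=> //; rewrite !deriveE//.
rewrite (@diff_comp _ _ _ _ f (@powR R ^~ a))//= -E1.
rewrite -[X in 'd _ _ X = _]mulr1 [LHS]linearZ /= mulrC.
by rewrite [in RHS]deriveE//; apply/derivable1_diffP.
Qed.

(** The exponent is general in the induction because differentiation lowers it by one. The exponents
    needed later are [-1], [2^-1] and [3^-1]. *)
Lemma Ck_on_powR {k U f} (a : R) : open U -> (forall q, U q -> 0 < f q) ->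
  Ck_on k U f -> Ck_on k U (fun q => f q `^ a).
Proof.
move=> oU f0; elim: k a => [|k IH] a.
  move=> cf q Uq; apply: (@continuous_comp _ _ _ f (@powR R ^~ a)).
    exact: cf.
  have [d1 _] := is_derive1_powR a (f0 q Uq).
  by apply: differentiable_continuous; apply/derivable1_diffP.
move=> cf; have [df Df] := cf; split=> [q Uq|v].
  by have [] := derive_powR a 0 oU f0 Uq (df q Uq).
apply: (Ck_on_eq oU _
  (Ck_onM oU (Ck_onM oU (Ck_on_cst a) (IH (a - 1) (Ck_onW cf))) (Df v))).
by move=> q Uq; have [_ ->] := derive_powR a v oU f0 Uq (df q Uq).
Qed.

Lemma Ck_onV {k U f} : open U -> (forall q, U q -> f q != 0) ->
  Ck_on k U f -> Ck_on k U (fun q => (f q)^-1).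
Proof.
move=> oU f0 cf.
(* A real power needs a positive base, so the inverse of [f] is written as [f] times the power [-1]
   of its square. *)
have f2 q : U q -> 0 < f q * f q.
  by move=> /f0 fq; rewrite -expr2 lt_neqAle eq_sym sqrf_eq0 fq sqr_ge0.
apply: (Ck_on_eq oU _ (Ck_onM oU cf (Ck_on_powR (-1) oU f2 (Ck_onM oU cf cf)))).
move=> q Uq; rewrite powRN powRr1 ?ltW ?f2//.
by rewrite invfM mulrA mulfV ?f0// mul1r.
Qed.

End Ck_on_scalar.

(** * Differentiation rules at a point for scalar functions *)

Section derive_pointwise.
Context {R : realType} {V : normedModType R}.
Implicit Types (f g : V -> R) (q v : V).

Lemma derive_mulf f g q v : derivable f q v -> derivable g q v ->
  'D_v (fun z => f z * g z) q = 'D_v f q * g q + f q * 'D_v g q.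
Proof.
move=> df dg; have := deriveM df dg; rewrite /GRing.scale/= => E.
by rewrite [LHS]E addrC [g q * _]mulrC.
Qed.

Lemma derive_addf f g q v : derivable f q v -> derivable g q v ->
  'D_v (fun z => f z + g z) q = 'D_v f q + 'D_v g q.
Proof. by move=> df dg; have := deriveD df dg. Qed.

Lemma derive_subf f g q v : derivable f q v -> derivable g q v ->
  'D_v (fun z => f z - g z) q = 'D_v f q - 'D_v g q.
Proof. by move=> df dg; have := deriveB df dg. Qed.

Lemma derive_mulfl (a : R) f q v : derivable f q v ->
  'D_v (fun z => a * f z) q = a * 'D_v f q.
Proof. by move=> df; have := deriveZ a df. Qed.

Lemma derive_mulfr (a : R) f q v : derivable f q v ->
  'D_v (fun z => f z * a) q = 'D_v f q * a.
Proof.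
move=> df; rewrite (_ : (fun z => f z * a) = fun z => a * f z).
  by rewrite derive_mulfl// mulrC.
by apply/funext => z; rewrite mulrC.
Qed.

Lemma derivable_mulf f g q v : derivable f q v -> derivable g q v ->
  derivable (fun z => f z * g z) q v.
Proof. exact: derivableM. Qed.

Lemma derivable_addf f g q v : derivable f q v -> derivable g q v ->
  derivable (fun z => f z + g z) q v.
Proof. exact: derivableD. Qed.

Lemma derivable_subf f g q v : derivable f q v -> derivable g q v ->
  derivable (fun z => f z - g z) q v.
Proof. exact: derivableB. Qed.

Lemma derive_expf f n q v : derivable f q v ->
  'D_v (fun z => f z ^+ n) q = n%:R * f q ^+ n.-1 * 'D_v f q.
Proof.
move=> df; rewrite (_ : (fun z => f z ^+ n) = f ^+ n).
  by rewrite deriveX.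
by apply/funext => z; rewrite fctE.
Qed.

Lemma derivable_expf f n q v : derivable f q v ->
  derivable (fun z => f z ^+ n) q v.
Proof.
move=> df; rewrite (_ : (fun z => f z ^+ n) = f ^+ n).
  exact: derivableX.
by apply/funext => z; rewrite fctE.
Qed.

Lemma derivable_invf f q v : f q != 0 -> derivable f q v ->
  derivable (fun z => (f z)^-1) q v.
Proof. exact: derivableV. Qed.

Lemma derive_invf f q v : f q != 0 -> derivable f q v ->
  'D_v (fun z => (f z)^-1) q = - f q ^- 2 * 'D_v f q.
Proof. exact: deriveV. Qed.

(** As [f] vanishes at [q], the difference quotient of the product is that of [f] times a value of
    [r], and continuity of [r] is enough to pass to the limit. This differentiates [y * r] on the
    line [y = 0] when [r] is known only to be continuous. *)
Lemma is_derive_mul0 f (r : V -> R) q v : f q = 0 ->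
  derivable f q v -> {for q, continuous r} ->
  is_derive q v (fun z => f z * r z) ('D_v f q * r q).
Proof.
move=> f0 df cr.
have H : h^-1 *: (((fun z => f z * r z) \o shift q) (h *: v) - f q * r q)
    @[h --> 0^'] --> 'D_v f q * r q.
  rewrite (_ : (fun h => _) = (fun h : R =>
      (h^-1 *: ((f \o shift q) (h *: v) - f q)) * r (h *: v + q))); last first.
    by apply/funext => h /=; rewrite f0 mul0r !subr0 -[in RHS]mulrA.
  apply: cvgM; first exact: df.
  apply: (@continuous_cvg _ _ _ _ _ _ r) => //.
  apply: cvg_within_filter.
  suff : h *: v + q @[h --> (0 : R)] --> 0 *: v + q by rewrite scale0r add0r.
  by apply: cvgD; [apply: cvgZr_tmp; exact: cvg_id|exact: cvg_cst].
by apply: DeriveDef; [apply: cvgP; exact: H|exact: cvg_lim H].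
Qed.

End derive_pointwise.

Section smooth_scalar.
Context {R : realType}.
Variables (U : set 'rV[R]_2) (oU : open U).
Implicit Types f g : 'rV[R]_2 -> R.

Lemma smooth_cst (a : R) : smooth_on U (fun _ => a).
Proof. by move=> k; exact: Ck_on_cst. Qed.

Lemma smoothD f g : smooth_on U f -> smooth_on U g ->
  smooth_on U (fun q => f q + g q).
Proof. by move=> sf sg k; exact: Ck_onD. Qed.

Lemma smoothB f g : smooth_on U f -> smooth_on U g ->
  smooth_on U (fun q => f q - g q).
Proof. by move=> sf sg k; exact: Ck_onB. Qed.

Lemma smoothM f g : smooth_on U f -> smooth_on U g ->
  smooth_on U (fun q => f q * g q).
Proof. by move=> sf sg k; exact: Ck_onM. Qed.

Lemma smoothX f n : smooth_on U f -> smooth_on U (fun q => f q ^+ n).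
Proof.
move=> sf; elim: n => [|n IH].
  by apply: (smooth_on_eq oU _ (@smooth_cst 1)) => q _; rewrite expr0.
by apply: (smooth_on_eq oU _ (smoothM sf IH)) => q _; rewrite exprS.
Qed.

Lemma smoothV f : (forall q, U q -> f q != 0) -> smooth_on U f ->
  smooth_on U (fun q => (f q)^-1).
Proof. by move=> f0 sf k; exact: Ck_onV. Qed.

Lemma smooth_powR f (a : R) : (forall q, U q -> 0 < f q) -> smooth_on U f ->
  smooth_on U (fun q => f q `^ a).
Proof. by move=> f0 sf k; exact: Ck_on_powR. Qed.

End smooth_scalar.

(** * Reduction to coordinates, composition, matrices and dot products *)

Section coordinates.
Context {R : realType}.
Implicit Types U : set 'rV[R]_2.

Lemma row_coordE n (W : Type) (g : W -> 'rV[R]_n) :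
  g = fun q => \sum_(j < n) g q 0 j *: delta_mx 0 j.
Proof. by apply/funext => q; rewrite -row_sum_delta. Qed.

Lemma derive_coord n (g : 'rV[R]_2 -> 'rV[R]_n) (q v : 'rV[R]_2) j :
  derivable g q v -> ('D_v g q) 0 j = 'D_v (fun z => g z 0 j) q.
Proof. by move=> dg; rewrite derive_mx// mxE. Qed.

Lemma differentiable_coordP n (g : 'rV[R]_2 -> 'rV[R]_n) (q : 'rV[R]_2) :
  differentiable g q <-> forall j, differentiable (fun z => g z 0 j) q.
Proof.
split=> [dg j|dg].
  apply: (@differentiable_comp _ _ _ _ g (fun M : 'rV[R]_n => M 0 j)) => //.
  exact: differentiable_coord.
rewrite [X in differentiable X _]row_coordE.
rewrite [X in differentiable X _](_ : _ =
  \sum_(j < n) (fun q => g q 0 j *: delta_mx 0 j)); last first.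
  by apply/funext => z; rewrite fct_sumE.
by apply: differentiable_sum => j; exact: differentiableZl.
Qed.

Lemma Ck_on_coordP n k U (g : 'rV[R]_2 -> 'rV[R]_n) : open U ->
  Ck_on k U g <-> forall j, Ck_on k U (fun z => g z 0 j).
Proof.
move=> oU; elim: k g => [|k IH] g; split.
- move=> cg j q Uq.
  apply: (@continuous_comp _ _ _ g (fun M : 'rV[R]_n => M 0 j)).
    exact: cg.
  exact: coord_continuous.
- move=> cg q Uq; suff : g z @[z --> q] --> g q by [].
  apply/(@cvgrPdist_le _ _ _ _ (nbhs_filter q)) => e e0; near=> z.
  rewrite /Num.Def.normr/= mx_normrE (bigmax_le _ (ltW e0))//= => -[i j] _.
  rewrite !mxE (ord1 i); move: j; near: z; apply: filter_forall => j.
  by have /cvgrPdist_le := cg j q Uq; exact.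
- move=> [dg Dg] j; split=> [q Uq|v].
    by have /differentiable_coordP := dg q Uq; exact.
  have /IH/(_ j) := Dg v; apply: Ck_on_eq => // q Uq.
  by rewrite derive_coord//; apply: diff_derivable; exact: dg.
- move=> cg; have dg q : U q -> differentiable g q.
    by move=> Uq; apply/differentiable_coordP => j; have [dg _] := cg j; exact: dg.
  split=> // v; apply/IH => j; have [_ Dg] := cg j.
  apply: (Ck_on_eq oU _ (Dg v)) => q Uq.
  by rewrite derive_coord//; apply: diff_derivable; exact: dg.
Unshelve. all: by end_near. Qed.

Lemma smooth_coordP n U (g : 'rV[R]_2 -> 'rV[R]_n) : open U ->
  smooth_on U g <-> forall j, smooth_on U (fun z => g z 0 j).
Proof.
move=> oU; split=> [sg j k|sg k]; first by have /Ck_on_coordP := sg k; exact.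
by apply/Ck_on_coordP => // j; exact: sg.
Qed.

Lemma deriveDr {W : normedModType R} (g : 'rV[R]_2 -> W) q a v w :
  differentiable g q -> 'D_(a *: v + w) g q = a *: 'D_v g q + 'D_w g q.
Proof. by move=> dg; rewrite !deriveE// linearP. Qed.

Lemma deriveZr {W : normedModType R} (g : 'rV[R]_2 -> W) q a v :
  differentiable g q -> 'D_(a *: v) g q = a *: 'D_v g q.
Proof. by move=> dg; rewrite !deriveE// linearZ. Qed.

Lemma derive_basis {W : normedModType R} (g : 'rV[R]_2 -> W) q v :
  differentiable g q ->
  'D_v g q = \sum_(j < 2) v 0 j *: 'D_(delta_mx 0 j) g q.
Proof.
move=> dg; rewrite deriveE// {1}(row_sum_delta v) linear_sum.
by apply: eq_bigr => j _; rewrite linearZ deriveE.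
Qed.

Lemma derive_comp {W : normedModType R} (phi : 'rV[R]_2 -> 'rV[R]_2)
    (g : 'rV[R]_2 -> W) q v :
  differentiable phi q -> differentiable g (phi q) ->
  'D_v (fun z => g (phi z)) q = 'D_('D_v phi q) g (phi q).
Proof.
move=> dphi dg; rewrite !deriveE//; last exact: differentiable_comp.
exact: (congr1 (@^~ v) (diff_comp dphi dg)).
Qed.

Lemma Ck_on_comp k U V (phi : 'rV[R]_2 -> 'rV[R]_2) (g : 'rV[R]_2 -> R) :
  open V -> (forall q, V q -> U (phi q)) ->
  Ck_on k V phi -> Ck_on k U g -> Ck_on k V (fun q => g (phi q)).
Proof.
move=> oV VU; elim: k g => [|k IH] g.
  move=> cphi cg q Vq; apply: (@continuous_comp _ _ _ phi g); first exact: cphi.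
  by apply: cg; exact: VU.
move=> cphi [dg Dg]; have [dphi Dphi] := cphi.
have dgphi q : V q -> differentiable g (phi q) by move=> /VU; exact: dg.
split=> [q Vq|v].
  by apply: (@differentiable_comp _ _ _ _ phi g); [exact: dphi|exact: dgphi].
(* The chain rule yields a derivative of [g] in a direction that moves with [q]; expanding that
   direction in the standard basis restores the constant directions that [Ck_on] handles. *)
apply: (Ck_on_eq oV (g := fun q => \sum_(j < 2)
    ('D_v phi q) 0 j * 'D_(delta_mx 0 j) g (phi q))) => [q Vq|].
  rewrite [RHS](derive_comp _ (dphi q Vq) (dgphi q Vq)).
  by rewrite (derive_basis _ (dgphi q Vq)).
apply: Ck_on_sum => // j; apply: Ck_onM => //; last first.
  exact: IH (Ck_onW cphi) (Dg _).
by have /Ck_on_coordP := Dphi v; exact.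
Qed.

Lemma smooth_comp U V (phi : 'rV[R]_2 -> 'rV[R]_2) (g : 'rV[R]_2 -> R) :
  open V -> (forall q, V q -> U (phi q)) ->
  smooth_on V phi -> smooth_on U g -> smooth_on V (fun q => g (phi q)).
Proof. by move=> oV VU sphi sg k; exact: (Ck_on_comp oV VU (sphi k) (sg k)). Qed.

Lemma Ck_on_det n k U (M : 'rV[R]_2 -> 'M[R]_n) : open U ->
  (forall i j, Ck_on k U (fun q => M q i j)) -> Ck_on k U (fun q => \det (M q)).
Proof.
move=> oU cM; apply: Ck_on_sum => // s; apply: Ck_onM => //.
  exact: Ck_on_cst.
by apply: Ck_on_prod => // i; exact: cM.
Qed.

(** Cramer's rule: an entry of the inverse is a cofactor divided by the determinant. *)
Lemma Ck_on_invmx n k U (M : 'rV[R]_2 -> 'M[R]_n) i j : open U ->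
  (forall q, U q -> M q \in unitmx) ->
  (forall i j, Ck_on k U (fun q => M q i j)) ->
  Ck_on k U (fun q => invmx (M q) i j).
Proof.
move=> oU uM cM.
apply: (Ck_on_eq oU (g := fun q => (\det (M q))^-1 *
    ((-1) ^+ (j + i) * \det (row' j (col' i (M q)))))) => [q Uq|].
  by rewrite /invmx uM// !mxE.
apply: Ck_onM => //.
  apply: Ck_onV => // [q /uM|]; first by rewrite unitmxE unitfE.
  exact: Ck_on_det.
apply: Ck_onM => //; first exact: Ck_on_cst.
apply: Ck_on_det => // a b.
by apply: (Ck_on_eq oU _ (cM (lift j a) (lift i b))) => q _; rewrite !mxE.
Qed.

Lemma Ck_on_mulmx m n r k U (A : 'rV[R]_2 -> 'M[R]_(m, n))
    (B : 'rV[R]_2 -> 'M[R]_(n, r)) i j : open U ->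
  (forall i j, Ck_on k U (fun q => A q i j)) ->
  (forall i j, Ck_on k U (fun q => B q i j)) ->
  Ck_on k U (fun q => (A q *m B q) i j).
Proof.
move=> oU cA cB; apply: (Ck_on_eq oU (g := fun q => \sum_l A q i l * B q l j)).
  by move=> q _; rewrite mxE.
by apply: Ck_on_sum => // l; exact: Ck_onM.
Qed.

Lemma Ck_on_dot n k U (a b : 'rV[R]_2 -> 'rV[R]_n) : open U ->
  Ck_on k U a -> Ck_on k U b -> Ck_on k U (fun q => dot (a q) (b q)).
Proof.
move=> oU /Ck_on_coordP ca /Ck_on_coordP cb.
by apply: Ck_on_sum => // j; apply: Ck_onM => //; [exact: ca|exact: cb].
Qed.

Lemma smooth_dot n U (a b : 'rV[R]_2 -> 'rV[R]_n) : open U ->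
  smooth_on U a -> smooth_on U b -> smooth_on U (fun q => dot (a q) (b q)).
Proof. by move=> oU sa sb k; exact: Ck_on_dot. Qed.

Lemma derive_dot n (a b : 'rV[R]_2 -> 'rV[R]_n) q v :
  derivable a q v -> derivable b q v ->
  'D_v (fun z => dot (a z) (b z)) q = dot ('D_v a q) (b q) + dot (a q) ('D_v b q).
Proof.
move=> da db.
have daj j : derivable (fun z => a z 0 j) q v by have /derivable_mxP := da; exact.
have dbj j : derivable (fun z => b z 0 j) q v by have /derivable_mxP := db; exact.
rewrite /dot [X in 'D_v X q](_ : _ =
  \sum_(j < n) (fun z => a z 0 j * b z 0 j)); last first.
  by apply/funext => z; rewrite fct_sumE.
rewrite derive_sum => [|j]; last by apply: derivableM.
rewrite -big_split; apply: eq_bigr => j _ /=.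
rewrite !derive_coord//.
by rewrite derive_mulf.
Qed.

End coordinates.

(** * Bilinearity of the dot product *)

Section dot_product.
Context {R : realType} {n : nat}.
Implicit Types x y z : 'rV[R]_n.

Lemma dotC x y : dot x y = dot y x.
Proof. by apply: eq_bigr => j _; rewrite mulrC. Qed.

Lemma dotDr x y z : dot x (y + z) = dot x y + dot x z.
Proof. by rewrite -big_split; apply: eq_bigr => j _; rewrite mxE mulrDr. Qed.

Lemma dotZr a x y : dot x (a *: y) = a * dot x y.
Proof. by rewrite /dot mulr_sumr; apply: eq_bigr => j _; rewrite mxE mulrCA. Qed.

Lemma dotNr x y : dot x (- y) = - dot x y.
Proof. by rewrite -scaleN1r dotZr mulN1r. Qed.

Lemma dotBr x y z : dot x (y - z) = dot x y - dot x z.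
Proof. by rewrite dotDr dotNr. Qed.

Lemma dot0r x : dot x 0 = 0.
Proof. by rewrite -(scale0r 0) dotZr mul0r. Qed.

Lemma dot_is_linear x : linear (dot x : 'rV[R]_n -> R).
Proof. by move=> a y z; rewrite dotDr dotZr. Qed.

(** Lets a row vector, through [dot], serve as the linear map in [is_diff]. *)
HB.instance Definition _ x :=
  GRing.isLinear.Build R 'rV[R]_n R *%R (dot x) (dot_is_linear x).

End dot_product.

(** * Symmetry of second derivatives *)

Section partial_derivatives.
Context {R : realType}.
Implicit Types (U : set 'rV[R]_2) (g : 'rV[R]_2 -> R).

Lemma rv2_decomp (v : 'rV[R]_2) :
  v = v 0 0 *: delta_mx 0 0 + v 0 1 *: delta_mx 0 1.
Proof.
rewrite {1}(row_sum_delta v) big_ord_recl big_ord1.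
by rewrite (_ : lift _ _ = 1)//; exact: val_inj.
Qed.

Lemma norm_rv2_ge (v : 'rV[R]_2) j : `|v 0 j| <= `|v|.
Proof.
rewrite [leRHS]/Num.Def.normr/= mx_normrE.
exact: (le_bigmax _ (fun ij => `|v ij.1 ij.2|) (0, j)).
Qed.

Lemma norm_rv2_le (v : 'rV[R]_2) (M : R) :
  `|v 0 0| <= M -> `|v 0 1| <= M -> `|v| <= M.
Proof.
move=> h0 h1; rewrite /Num.Def.normr/= mx_normrE; apply: bigmax_le.
  exact: le_trans (normr_ge0 _) h0.
move=> -[i j] _ /=; rewrite (ord1 i).
by case: (unliftP 0 j) => [j'|] -> //; rewrite (ord1 j') (_ : lift _ _ = 1)//; apply/val_inj.
Qed.

Lemma near_normP (V : normedModType R) (q : V) (P : V -> Prop) :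
  (\forall z \near q, P z) <->
  exists2 e : R, 0 < e & forall z, `|z - q| < e -> P z.
Proof.
split=> [/nbhs_normP[e /= e0 H]|[e e0 H]].
  by exists e => // z; rewrite distrC => /H.
by apply/nbhs_normP; exists e => //= z /=; rewrite distrC; exact: H.
Qed.

Lemma continuous_normP (V W : normedModType R) (q : V) (g : V -> W) :
  {for q, continuous g} <-> forall e : R, 0 < e ->
    exists2 d : R, 0 < d & forall z, `|z - q| < d -> `|g z - g q| < e.
Proof.
split=> [/(@cvgrPdist_lt _ _ _ _ (nbhs_filter q)) H e e0|H].
  have /near_normP[d d0 Hd] := H e e0; exists d => // z /Hd.
  by rewrite distrC.
apply/(@cvgrPdist_lt _ _ _ _ (nbhs_filter q)) => e e0; apply/near_normP.
by have [d d0 Hd] := H e e0; exists d => // z /Hd; rewrite distrC.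
Qed.

Lemma Ck_on_id k U : Ck_on k U (fun q : 'rV[R]_2 => q).
Proof. by apply: (@Ck_on_linear _ _ k U idfun) => q; exact: cvg_id. Qed.

Lemma continuous_dot (l : 'rV[R]_2) : continuous (dot l).
Proof.
by move=> q; have := @Ck_on_dot R 2 0 setT _ _ openT (Ck_on_cst l) (Ck_on_id _ _); exact.
Qed.

(** Mean value theorem for a step [a] of either sign along a fixed vector [v]: the derivative stays
    along [v] itself, so it can be a partial derivative, and the intermediate parameter is bounded
    in absolute value only. *)
Lemma mvt_scaled n (g : 'rV[R]_n -> R) (q v : 'rV[R]_n) (a : R) :
  (forall s : R, `|s| <= `|a| -> derivable g (q + s *: v) v) ->
  exists2 s : R, `|s| <= `|a| & g (q + a *: v) - g q = a * 'D_v g (q + s *: v).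
Proof.
move=> dg.
have d1 (s : R) : `|s| <= `|a| ->
    is_derive s 1 (fun s => g (q + s *: v)) ('D_v g (q + s *: v)).
  by move=> /dg; apply: derivable_line.
have c1 (i : interval R) : {in i, forall s : R, `|s| <= `|a|} ->
    {within [set` i], continuous (fun s => g (q + s *: v))}.
  move=> ia; apply: derivable_within_continuous => s /ia sa.
  by have [] := d1 s sa.
have [a0|a0|->] := ltgtP a 0; last first.
- by exists 0 => //; rewrite scale0r addr0 subrr mul0r.
- have ib : {in `[0, a], forall s : R, `|s| <= `|a|}.
    move=> s; rewrite in_itv/= => /andP[s0 sa].
    by rewrite !ger0_norm// ltW.
  have [|c cI] := MVT a0 (df := fun s => 'D_v g (q + s *: v)) _ (c1 _ ib).
    by move=> s /subset_itv_oo_cc /ib; exact: d1.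
  rewrite scale0r addr0 subr0 mulrC => Ec; exists c => //.
  exact: ib (subset_itv_oo_cc cI).
- have ib : {in `[a, 0], forall s : R, `|s| <= `|a|}.
    move=> s; rewrite in_itv/= => /andP[sa s0].
    by rewrite !ler0_norm// ?lerN2// ltW.
  have [|c cI] := MVT a0 (df := fun s => 'D_v g (q + s *: v)) _ (c1 _ ib).
    by move=> s /subset_itv_oo_cc /ib; exact: d1.
  rewrite scale0r addr0 sub0r mulrN mulrC => Ec.
  exists c; last by rewrite -opprB Ec opprK.
  exact: ib (subset_itv_oo_cc cI).
Qed.

Let weighted_le (a b s x y : R) : 0 <= x -> 0 <= y -> a <= s -> b <= s -> 0 <= s ->
  a * x + b * y <= s * (x + y + 1).
Proof.
move=> x0 y0 ha hb s0; rewrite !mulrDr -[leLHS]addr0 mulr1.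
by rewrite lerD// lerD// ler_wpM2r.
Qed.

Let halves_le (a b x y e n : R) : 0 <= a -> 0 <= b -> 0 <= x -> 0 <= y ->
  a <= n -> b <= n -> x <= e / 2 -> y <= e / 2 -> a * x + b * y <= e * n.
Proof.
by move=> *; rewrite [e]splitr mulrDl lerD// mulrC ler_pM.
Qed.

(* Increments are estimated along the two sides of a coordinate rectangle. *)
Lemma continuous_partials_diff g (q : 'rV[R]_2) :
  (\forall z \near q, forall j, derivable g z (delta_mx 0 j)) ->
  (forall j, {for q, continuous (fun z => 'D_(delta_mx 0 j) g z)}) ->
  differentiable g q.
Proof.
move=> /near_normP[r r0 dg] cg.
pose l : 'rV[R]_2 := \row_j 'D_(delta_mx 0 j) g q.
suff /(@ex_diff _ _ _ _ _ _ _) : is_diff q g (dot l) by [].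
apply: eps_is_diff => [|e e0].
  exact: continuous_dot.
have e20 : 0 < e / 2 by rewrite divr_gt0.
have /(continuous_normP q) /(_ _ e20)[d0 d00 H0] := cg 0.
have /(continuous_normP q) /(_ _ e20)[d1 d10 H1] := cg 1.
apply/near_normP; exists (Num.min r (Num.min d0 d1)) => [|z].
  by rewrite !lt_min r0 d00.
rewrite !lt_min => /and3P[zr zd0 zd1].
set v := z - q.
have small (a b : R) : `|a| <= `|v 0 0| -> `|b| <= `|v 0 1| ->
    `|q + a *: delta_mx 0 0 + b *: delta_mx 0 1 - q| <= `|v|.
  move=> ha hb; rewrite -(addrA q) [q + _]addrC addrK; apply: norm_rv2_le; rewrite !mxE/=.
    by rewrite mulr1 mulr0 addr0 (le_trans ha)// norm_rv2_ge.
  by rewrite mulr1 mulr0 add0r (le_trans hb)// norm_rv2_ge.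
pose m := q + v 0 0 *: delta_mx 0 0.
have small0 (a : R) : `|a| <= `|v 0 0| -> `|q + a *: delta_mx 0 0 - q| <= `|v|.
  by move=> ha; have := small a 0 ha; rewrite scale0r addr0; apply; rewrite normr0.
have [s sv Es] : exists2 s : R, `|s| <= `|v 0 0| & g m - g q =
    v 0 0 * 'D_(delta_mx 0 0) g (q + s *: delta_mx 0 0).
  apply: mvt_scaled => s /small0 sv.
  by apply: dg; exact: le_lt_trans sv zr.
have [t tv Et] : exists2 t : R, `|t| <= `|v 0 1| & g (m + v 0 1 *: delta_mx 0 1) - g m =
    v 0 1 * 'D_(delta_mx 0 1) g (m + t *: delta_mx 0 1).
  apply: mvt_scaled => t /(small (v 0 0) t (lexx _)) tv.
  by apply: dg; exact: le_lt_trans tv zr.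
have Ez : z = m + v 0 1 *: delta_mx 0 1.
  by rewrite /m -addrA -rv2_decomp /v addrC subrK.
have {}H0 := H0 _ (le_lt_trans (small0 s sv) zd0).
have {}H1 := H1 _ (le_lt_trans (small (v 0 0) t (lexx _) tv) zd1).
have -> : g z - g q - dot l v =
    v 0 0 * ('D_(delta_mx 0 0) g (q + s *: delta_mx 0 0) - 'D_(delta_mx 0 0) g q)
  + v 0 1 * ('D_(delta_mx 0 1) g (m + t *: delta_mx 0 1) - 'D_(delta_mx 0 1) g q).
  rewrite !mulrBr -Es -Et -Ez /dot big_ord_recl big_ord1 !mxE.
  rewrite (_ : lift _ _ = 1); last exact: val_inj.
  ring.
rewrite (le_trans (ler_normD _ _))// !normrM.
exact: (halves_le (normr_ge0 _) (normr_ge0 _) (normr_ge0 _) (normr_ge0 _)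
  (norm_rv2_ge v 0) (norm_rv2_ge v 1) (ltW H0) (ltW H1)).
Qed.

Lemma derive_translate (W : normedModType R) (g : 'rV[R]_2 -> W) (q v c : 'rV[R]_2) :
  derivable g (q + c) v ->
  is_derive q v (fun z => g (z + c)) ('D_v g (q + c)).
Proof.
have E : (fun h : R => h^-1 *: (((fun z => g (z + c)) \o shift q) (h *: v)
    - g (q + c))) =
  (fun h : R => h^-1 *: ((g \o shift (q + c)) (h *: v) - g (q + c))).
  by apply/funext => h /=; rewrite addrA.
by move=> dg; apply: DeriveDef; rewrite /derivable /derive /= E.
Qed.

(* Both iterated derivatives are limits of the double difference
   [g (q + s v + s w) - g (q + s v) - g (q + s w) + g q] divided by [s ^+ 2]. *)
Lemma double_difference U g (q v w : 'rV[R]_2) (e : R) :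
  open U -> U q -> Ck_on 2 U g -> 0 < e ->
  exists2 d : R, 0 < d & forall s : R, 0 < s < d ->
    `|g (q + s *: v + s *: w) - g (q + s *: v) - g (q + s *: w) + g q
      - s ^+ 2 * 'D_w (fun z => 'D_v g z) q| <= s ^+ 2 * e.
Proof.
move=> oU Uq cg e0; have [dg Dg] := cg; have [dDg DDg] := Dg v.
have /continuous_normP/(_ _ e0)[d d0 Hd] := DDg w q Uq.
have /near_normP[r r0 Hr] := near_open oU Uq (fun z Uz => Uz).
(* The summand [1] keeps [N] positive when [v] and [w] both vanish. *)
pose N := `|v| + `|w| + 1.
have N0 : 0 < N by rewrite ltr_wpDl// addr_ge0.
have m0 : 0 < Num.min d r by rewrite lt_min d0.
exists (Num.min d r / N) => [|s /andP[s0]]; first by rewrite divr_gt0.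
rewrite ltr_pdivlMr// => sN.
have small (a b : R) : `|a| <= `|s| -> `|b| <= `|s| ->
    `|q + a *: v + b *: w - q| < Num.min d r.
  move=> ha hb; apply: le_lt_trans sN; rewrite -(addrA q) [q + _]addrC addrK.
  rewrite (gtr0_norm s0) in ha hb.
  apply: le_trans (ler_normD _ _) _; rewrite !normrZ.
  exact: weighted_le (normr_ge0 v) (normr_ge0 w) ha hb (ltW s0).
have Us (a b : R) : `|a| <= `|s| -> `|b| <= `|s| -> U (q + a *: v + b *: w).
  by move=> ha hb; apply: Hr; have := small a b ha hb; rewrite lt_min => /andP[].
have Us0 (a : R) : `|a| <= `|s| -> U (q + a *: v).
  by move=> ha; have := Us a 0 ha; rewrite scale0r addr0; apply; rewrite normr0.
have dk (a : R) : `|a| <= `|s| ->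
    is_derive (q + a *: v) v (fun z => g (z + s *: w) - g z)
      ('D_v g (q + a *: v + s *: w) - 'D_v g (q + a *: v)).
  move=> ha.
  have := @derive_translate _ g (q + a *: v) v (s *: w)
    (diff_derivable (dg _ (Us _ _ ha (lexx _)))).
  have : is_derive (q + a *: v) v g ('D_v g (q + a *: v)).
    by apply: derivableP; apply: diff_derivable; apply: dg; exact: Us0.
  by move=> h1 h2; exact: is_deriveB.
(* The double difference is the increment along [v] of [g (z + s w) - g z]. One mean value in
   direction [v], then one in direction [w] for ['D_v g], produce the factor [s ^+ 2]. *)
have [a ha Ea] := @mvt_scaled 2 (fun z => g (z + s *: w) - g z) q v s
  (fun a ha => @ex_derive _ _ _ _ _ _ _ (dk a ha)).
have [b hb Eb] := @mvt_scaled 2 (fun z => 'D_v g z) (q + a *: v) w s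
  (fun b hb => diff_derivable (dDg _ (Us _ _ ha hb))).
rewrite (@derive_val _ _ _ _ _ _ _ (dk a ha)) Eb in Ea.
rewrite (_ : _ + g q = (g (q + s *: v + s *: w) - g (q + s *: v)) -
  (g (q + s *: w) - g q)); last by ring.
rewrite Ea mulrA -expr2 -mulrBr normrM ger0_norm ?sqr_ge0//.
apply: ler_wpM2l; first exact: sqr_ge0.
by apply/ltW/Hd; have := small a b ha hb; rewrite lt_min => /andP[].
Qed.

Lemma schwarz U g (q v w : 'rV[R]_2) : open U -> U q -> Ck_on 2 U g ->
  'D_v (fun z => 'D_w g z) q = 'D_w (fun z => 'D_v g z) q.
Proof.
move=> oU Uq cg; apply/eqP; rewrite -subr_eq0 -normr_le0.
apply/ler_addgt0Pr => e e0; rewrite add0r.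
have e20 : 0 < e / 2 by rewrite divr_gt0.
have [d1 d10 H1] := double_difference v w oU Uq cg e20.
have [d2 d20 H2] := double_difference w v oU Uq cg e20.
have [s s0 [sd1 sd2]] : exists2 s : R, 0 < s & s < d1 /\ s < d2.
  have m0 : 0 < Num.min d1 d2 by rewrite lt_min d10.
  exists (Num.min d1 d2 / 2); first by rewrite divr_gt0.
  have : Num.min d1 d2 / 2 < Num.min d1 d2.
    by rewrite ltr_pdivrMr// mulr_natr mulr2n ltrDl.
  by rewrite {2}/Num.min lt_min => /andP.
have s20 : 0 < s ^+ 2 by rewrite exprn_gt0.
have /H1 {}H1 : 0 < s < d1 by rewrite s0.
have /H2 {}H2 : 0 < s < d2 by rewrite s0.
rewrite -(ler_pM2l s20) -[s ^+ 2 in leLHS]gtr0_norm// -normrM.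
rewrite [e in leRHS]splitr [leRHS]mulrDr; apply: le_trans (lerD H1 H2).
apply: le_trans (ler_normB _ _).
have alg (a b c d f x y : R) :
  a * (x - y) = b - c - d + f - a * y - (b - d - c + f - a * x).
  by ring.
by rewrite (addrAC q (s *: w)) -alg.
Qed.

End partial_derivatives.

(** * Smooth Taylor quotients *)

Section taylor_remainder.
Context {R : realType}.

Lemma Ck_on_cont {W : normedModType R} k (U : set 'rV[R]_2) (g : 'rV[R]_2 -> W) q :
  Ck_on k U g -> U q -> {for q, continuous g}.
Proof.
elim: k => [|k IH]; first by move=> cg Uq; exact: cg.
by move=> /Ck_onW; exact: IH.
Qed.

(** Continuous partial derivatives imply differentiability. It is therefore enough to compute
    directional derivatives, which is all that is available for Taylor quotients. *)
Lemma Ck_on_partials k (U : set 'rV[R]_2) (g : 'rV[R]_2 -> R) : open U ->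
  (forall q v, U q -> derivable g q v) ->
  (forall v, Ck_on k U (fun q => 'D_v g q)) -> Ck_on k.+1 U g.
Proof.
move=> oU dg cg; split=> // q Uq; apply: continuous_partials_diff.
  by apply: (near_open oU Uq) => z Uz j; exact: dg.
by move=> j; exact: Ck_on_cont (cg _) Uq.
Qed.

Lemma smooth_coord (U : set 'rV[R]_2) j : smooth_on U (fun q => q 0 j).
Proof.
move=> k; apply: Ck_onS (@subsetT _ _) _.
exact: ((Ck_on_coordP _ _ openT).1 (Ck_on_id k setT)).
Qed.

Lemma derive_id_coord (q v : 'rV[R]_2) j : 'D_v (fun z : 'rV[R]_2 => z 0 j) q = v 0 j.
Proof. by rewrite -derive_coord// derive_id. Qed.

Lemma is_derive_dot (l p q v : 'rV[R]_2) :
  is_derive q v (fun z => dot l (z - p)) (dot l v).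
Proof.
have [d1 E1] := @derive_translate R _ id q v (- p) (@derivable_id _ _ _ _).
have d2 : derivable (fun _ : 'rV[R]_2 => l) q v by exact: derivable_cst.
apply: DeriveDef; first last.
  rewrite (derive_dot d2 d1) derive_cst dotC dot0r add0r.
  by rewrite [X in dot l X]E1 derive_id.
apply: diff_derivable.
apply: (@smooth_diff _ _ setT (fun z => dot l (z - p))) => // k.
apply: Ck_on_dot; [exact: openT|exact: Ck_on_cst|].
by apply: Ck_onD; [exact: openT|exact: Ck_on_id|exact: Ck_on_cst].
Qed.

Variables (p l w : 'rV[R]_2) (V : set 'rV[R]_2).
Hypotheses (lw : dot l w = 1) (oV : open V).
(** [y] is an affine coordinate growing at unit rate along [w], and [proj] moves a point along [w]
    to the line [y = 0]. The hypothesis [starV] keeps the segment between the two inside [V]. *)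
Let y (q : 'rV[R]_2) : R := dot l (q - p).
Hypothesis starV : forall q (t : R), V q -> 0 <= t <= 1 -> V (q - (t * y q) *: w).
Let proj (q : 'rV[R]_2) : 'rV[R]_2 := q - y q *: w.
Let Dw n (G : 'rV[R]_2 -> R) := iter n (fun g q => 'D_w g q) G.

(** Taylor remainder of order [n] in the single variable [y], with base point [proj q], the foot of
    [q] on the line [y = 0]. *)
Fixpoint taylor_rest n (G : 'rV[R]_2 -> R) : 'rV[R]_2 -> R :=
  if n is m.+1 then
    fun q => taylor_rest m G q - y q ^+ m / m`!%:R * Dw m G (proj q)
  else G.

(** On [y = 0] the remainder divided by [y ^+ n] would be meaningless; the value put there is the
    next Taylor coefficient, its limit. *)
Definition taylor_quot n (G : 'rV[R]_2 -> R) (q : 'rV[R]_2) : R :=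
  if y q == 0 then Dw n G q / n`!%:R else taylor_rest n G q / y q ^+ n.

Let yZ q (t : R) : y (q + t *: w) = y q + t.
Proof. by rewrite /y (addrAC q) (dotDr l (q - p)) dotZr lw mulr1. Qed.

Let y_proj q : y (proj q) = 0.
Proof. by rewrite /proj -scaleNr yZ subrr. Qed.

Let proj_id q : y q = 0 -> proj q = q.
Proof. by move=> y0; rewrite /proj y0 scale0r subr0. Qed.

Let V_proj q : V q -> V (proj q).
Proof. by move=> /(starV (t := 1)); rewrite mul1r; apply; rewrite ler01 lexx. Qed.

Let smooth_y k : Ck_on k V y.
Proof.
apply: Ck_on_dot => //; first exact: Ck_on_cst.
by apply: Ck_onD => //; [exact: Ck_on_id|exact: Ck_on_cst].
Qed.

Lemma smooth_proj : smooth_on V proj.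
Proof.
move=> k; apply/Ck_on_coordP => // j.
apply: (Ck_on_eq oV (g := fun q => q 0 j - y q * w 0 j)) => [q _|].
  by rewrite !mxE.
by apply: Ck_onB => //; [exact: smooth_coord|apply: Ck_onM => //; exact: Ck_on_cst].
Qed.

Lemma derive_proj q v : V q -> 'D_v proj q = v - dot l v *: w.
Proof.
move=> Vq; have dy := is_derive_dot l p q v.
have dproj : derivable proj q v by apply: smooth_derivable Vq; exact: smooth_proj.
apply/rowP => j; rewrite derive_coord// !mxE.
rewrite (_ : (fun z => proj z 0 j) = fun z => z 0 j - y z * w 0 j); last first.
  by apply/funext => z; rewrite !mxE.
have d1 : derivable (fun z : 'rV[R]_2 => z 0 j) q v.
  by apply: smooth_derivable Vq; exact: smooth_coord.
have d2 : derivable y q v by exact: (@ex_derive _ _ _ _ _ _ _ dy).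
have d3 : derivable (fun z => y z * w 0 j) q v.
  exact: (@derivable_mulf _ _ y (fun _ => w 0 j)).
by rewrite derive_subf// derive_id_coord derive_mulfr// (@derive_val _ _ _ _ _ _ _ dy).
Qed.

Let Dw_smooth n G : smooth_on V G -> smooth_on V (Dw n G).
Proof. by move=> sG; elim: n => [//|n IH]; exact: smooth_derive. Qed.

Let Dw_comm n G v q : smooth_on V G -> V q ->
  'D_v (Dw n G) q = Dw n (fun z => 'D_v G z) q.
Proof.
move=> sG; elim: n q => [//|n IH] q Vq /=.
rewrite (schwarz _ _ oV Vq (Dw_smooth n sG 2)).
exact: derive_eq_on oV IH Vq.
Qed.

Let derive_Dw_proj n G v q : smooth_on V G -> V q ->
  'D_v (fun z => Dw n G (proj z)) q = 'D_(v - dot l v *: w) (Dw n G) (proj q).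
Proof.
move=> sG Vq; rewrite derive_comp ?derive_proj//.
  by apply: smooth_diff Vq; exact: smooth_proj.
by apply: smooth_diff (V_proj Vq); exact: Dw_smooth.
Qed.

Let smooth_Dw_proj n G : smooth_on V G -> smooth_on V (fun z => Dw n G (proj z)).
Proof.
move=> sG; exact: (smooth_comp oV V_proj smooth_proj (Dw_smooth n sG)).
Qed.

Let smooth_ypow n k : Ck_on k V (fun q => y q ^+ n / n`!%:R).
Proof.
apply: Ck_onM => //; last exact: Ck_on_cst.
elim: n => [|n IH].
  by apply: (Ck_on_eq oV _ (Ck_on_cst (1 : R))) => q _; rewrite expr0.
by apply: (Ck_on_eq oV _ (Ck_onM oV (@smooth_y k) IH)) => q _; rewrite exprS.
Qed.

Lemma smooth_taylor_rest n G : smooth_on V G -> smooth_on V (taylor_rest n G).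
Proof.
move=> sG; elim: n => [//|n IH] k; apply: Ck_onB => //.
by apply: Ck_onM => //; exact: smooth_Dw_proj.
Qed.

Lemma taylor_rest0 n G q : y q = 0 -> taylor_rest n.+1 G q = 0.
Proof.
move=> y0; elim: n => [|n /= IH].
  by rewrite /= expr0 fact0 divr1 mul1r proj_id// subrr.
by rewrite IH y0 expr0n/= mul0r mul0r subrr.
Qed.

Let derive_ypow n q v : 'D_v (fun z => y z ^+ n / n`!%:R) q =
  dot l v * (n%:R * y q ^+ n.-1 / n`!%:R).
Proof.
have dy := is_derive_dot l p q v.
have d2 : derivable y q v by exact: (@ex_derive _ _ _ _ _ _ _ dy).
rewrite derive_mulfr; last exact: derivable_expf.
rewrite derive_expf// (@derive_val _ _ _ _ _ _ _ dy); ring.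
Qed.

(** Split [v] into a multiple of [w] and a vector killed by [dot l]. Along the latter [y] is
    constant and the derivative falls on [G] alone. Along [w] the foot [proj q] is constant and each
    power of [y] drops by one, which leaves the remainder of order [n] of ['D_w G]. *)
Lemma derive_taylor_rest n G v q : smooth_on V G -> V q ->
  'D_v (taylor_rest n.+1 G) q =
    taylor_rest n.+1 (fun z => 'D_(v - dot l v *: w) G z) q
    + dot l v * taylor_rest n (fun z => 'D_w G z) q.
Proof.
move=> sG Vq; set v' := v - dot l v *: w.
have split_v (H : 'rV[R]_2 -> R) z : differentiable H z ->
    'D_v H z = 'D_v' H z + dot l v * 'D_w H z.
  move=> dH; rewrite !deriveE// /v' linearB linearZ /= [_ *: _]/GRing.scale/=; ring.
have dterm m : 'D_v (fun z => y z ^+ m / m`!%:R * Dw m G (proj z)) q =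
    y q ^+ m / m`!%:R * Dw m (fun z => 'D_v' G z) (proj q)
    + dot l v * (m%:R * y q ^+ m.-1 / m`!%:R) * Dw m G (proj q).
  rewrite derive_mulf.
  - by rewrite derive_Dw_proj// derive_ypow Dw_comm 1?addrC//; exact: V_proj.
  - by apply: smooth_derivable Vq; exact: smooth_ypow.
  - by apply: smooth_derivable Vq; exact: smooth_Dw_proj.
have dstep m : 'D_v (taylor_rest m.+1 G) q = 'D_v (taylor_rest m G) q -
    'D_v (fun z => y z ^+ m / m`!%:R * Dw m G (proj z)) q.
  rewrite [LHS]derive_subf//; apply: smooth_derivable Vq.
    exact: smooth_taylor_rest.
  by apply: smoothM => //; exact: smooth_Dw_proj.
elim: n => [|n IH].
  rewrite dstep dterm /= !expr0 !fact0 split_v; last exact: smooth_diff sG Vq.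
  by rewrite mul0r mul0r mulr0 mul0r addr0; ring.
rewrite dstep IH dterm [X in _ = X + _]/= [X in _ = _ + dot l v * X]/=.
have -> : Dw n.+1 G (proj q) = Dw n (fun z => 'D_w G z) (proj q).
  by rewrite /Dw iterSr.
rewrite [taylor_rest n.+1 _]/=.
have -> : n.+1%:R * y q ^+ n.+1.-1 / n.+1`!%:R = y q ^+ n / n`!%:R :> R.
  by rewrite factS natrM invfM mulrACA mulfV ?mul1r// pnatr_eq0.
rewrite -[X in _ = _ - _ * X + _]/(Dw n.+1 (fun z => 'D_v' G z) (proj q)).
ring.
Qed.

(** Near [y = 0] this presents the quotient as a smooth function of [proj q] plus [y] times a
    continuous factor, a form to which [is_derive_mul0] applies. *)
Lemma taylor_quot_step n G q : V q ->
  taylor_quot n G q = Dw n G (proj q) / n`!%:R + y q * taylor_quot n.+1 G q.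
Proof.
move=> Vq; rewrite /taylor_quot; case: eqP => [y0|/eqP y0].
  by rewrite proj_id// y0 mul0r addr0.
have alg (a b f Y T : R) : f != 0 -> Y != 0 -> T != 0 ->
    a / T = b / f + Y * ((a - T / f * b) / (Y * T)).
  by move=> f0 Y0 T0; field; rewrite f0 Y0 T0.
by rewrite /= exprS; apply: alg; rewrite ?expf_neq0// pnatr_eq0 -lt0n fact_gt0.
Qed.

Lemma taylor_rest_quot n G q : taylor_rest n G q = y q ^+ n * taylor_quot n G q.
Proof.
rewrite /taylor_quot; case: eqP => [y0|/eqP y0].
  case: n => [|n]; first by rewrite expr0 mul1r fact0 divr1.
  by rewrite taylor_rest0// y0 expr0n mul0r.
by rewrite mulrC divfK// expf_neq0.
Qed.

Let Dw_cst0 n : Dw n (fun _ => 0) = fun _ => 0.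
Proof. by elim: n => [//|n /= ->]; apply/funext => z; rewrite derive_cst. Qed.

Let taylor_rest_cst0 n q : taylor_rest n (fun _ => 0) q = 0.
Proof. by elim: n => [//|n /= ->]; rewrite Dw_cst0 mulr0 subr0. Qed.

Lemma derive_taylor_rest_w n G q : smooth_on V G -> V q ->
  'D_w (taylor_rest n.+1 G) q = taylor_rest n (fun z => 'D_w G z) q.
Proof.
move=> sG Vq; rewrite derive_taylor_rest// lw scale1r subrr mul1r.
rewrite (_ : (fun z => 'D_0 G z) = fun _ => 0) ?taylor_rest_cst0 ?add0r//.
by apply/funext => z; rewrite derive0.
Qed.

(* Lagrange form of the remainder, from [n] applications of the mean value
   theorem to [taylor_rest n G - c y ^+ n]. *)
Lemma taylor_quot_lagrange n G q : smooth_on V G -> V q ->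
  exists2 t : R, 0 <= t <= 1 &
    taylor_quot n G q = Dw n G (q - (t * y q) *: w) / n`!%:R.
Proof.
elim: n G q => [|n IH] G q sG Vq.
  exists 0; first by rewrite lexx ler01.
  rewrite /taylor_quot /= expr0 fact0 !divr1 mul0r scale0r subr0.
  by rewrite if_same.
have [y0|y0] := eqVneq (y q) 0.
  exists 0; first by rewrite lexx ler01.
  by rewrite mul0r scale0r subr0 /taylor_quot y0 eqxx.
(* With this [c], [Phi] vanishes at [q] as well as at [proj q], so ['D_w Phi] vanishes at some [z]
   between them; that equation identifies [c] with a quotient of order [n] of ['D_w G] at [z], up to
   the factor [n.+1]. *)
pose c := taylor_quot n.+1 G q.
pose Phi z := taylor_rest n.+1 G z - c * y z ^+ n.+1.
have dy z v : derivable y z v.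
  exact: (@ex_derive _ _ _ _ _ _ _ (is_derive_dot l p z v)).
have dyX z v : derivable (fun z => c * y z ^+ n.+1) z v.
  apply: (@derivable_mulf _ _ (fun _ => c)); first exact: derivable_cst.
  exact: derivable_expf.
have dR z v : V z -> derivable (taylor_rest n.+1 G) z v.
  by move=> Vz; apply: smooth_derivable Vz; exact: smooth_taylor_rest.
have line t : q + t *: (- y q *: w) = q - (t * y q) *: w.
  by rewrite scalerA mulrN scaleNr.
have [|t /andP[t0 t1]] := @mvt_line R 2 Phi q (- y q *: w).
  move=> t t01; apply: derivable_subf => //.
  by apply: dR; rewrite line; exact: starV.
have -> : q + - y q *: w = proj q by rewrite scaleNr.
rewrite /Phi taylor_rest0// y_proj expr0n mulr0 subr0 taylor_rest_quot.
rewrite [_ * taylor_quot _ _ _]mulrC subrr subrr line.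
set z := q - _ *: w; have Vz : V z by apply: starV; rewrite ?ltW.
have yz : y z = (1 - t) * y q by rewrite /z -scaleNr yZ mulrBl mul1r.
have dwPhi : 'D_w Phi z = taylor_rest n (fun z => 'D_w G z) z
    - c * (n.+1%:R * y z ^+ n).
  rewrite derive_subf// ?derive_taylor_rest_w//; last exact: dR.
  rewrite derive_mulfl; last exact: derivable_expf.
  rewrite derive_expf// (@derive_val _ _ _ _ _ _ _ (is_derive_dot l p z w)).
  by rewrite lw mulr1.
have dPhi : differentiable Phi z.
  apply: (smooth_diff (U := V)) => //; apply: smoothB => //.
    exact: smooth_taylor_rest.
  by apply: smoothM => //; [exact: smooth_cst|apply: smoothX].
rewrite deriveE// linearZ/= -deriveE// dwPhi taylor_rest_quot => /esym/eqP.
rewrite [_ *: _]/GRing.scale/= mulf_eq0 oppr_eq0 (negPf y0)/= subr_eq0.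
have yz0 : y z != 0 by rewrite yz mulf_neq0// subr_eq0 gt_eqF.
rewrite mulrA [c * _]mulrC [eqbRHS]mulrC => /eqP/(mulfI (expf_neq0 n yz0)) E.
have [s /andP[s0 s1] Es] := IH _ z (smooth_derive w sG) Vz.
(* The point [z] lies a fraction [t] of the way from [q] to its foot, and the induction moves a
   fraction [s] of the remaining [1 - t]. *)
exists (t + s * (1 - t)).
  by apply/andP; split; nra.
have Ec : taylor_quot n.+1 G q = taylor_quot n (fun z => 'D_w G z) z / n.+1%:R.
  by rewrite E mulrAC mulfV ?mul1r// pnatr_eq0.
have EI z' : Dw n (fun z => 'D_w G z) z' = Dw n.+1 G z' by rewrite /Dw iterSr.
rewrite Ec Es EI yz /z.
have -> : q - (t * y q) *: w - (s * ((1 - t) * y q)) *: w =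
    q - ((t + s * (1 - t)) * y q) *: w.
  by rewrite -addrA -opprD -scalerDl; congr (q - _ *: w); ring.
by rewrite factS natrM invfM mulrA mulrAC.
Qed.

Let derive_y q v : is_derive q v y (dot l v).
Proof. exact: is_derive_dot. Qed.

Let derivable_y q v : derivable y q v.
Proof. exact: (@ex_derive _ _ _ _ _ _ _ (derive_y q v)). Qed.

Let y_neq0_open : open (V `&` [set q | y q != 0]).
Proof.
apply: openI => //; apply: (@open_comp _ _ y [set x : R | x != 0]).
  move=> q _; apply: (@Ck_on_cont _ 0 setT) => //.
  apply: Ck_on_dot; [exact: openT|exact: Ck_on_cst|].
  by apply: Ck_onD; [exact: openT|exact: Ck_on_id|exact: Ck_on_cst].
exact: open_neq.
Qed.

Let taylor_quot_near n G q : V q -> y q != 0 ->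
  \forall z \near q, taylor_rest n G z / y z ^+ n = taylor_quot n G z.
Proof.
move=> Vq y0; apply: (near_open y_neq0_open) => // z [_ /= yz0].
by rewrite /taylor_quot (negPf yz0).
Qed.

(** Off the line [y = 0] this is a genuine quotient of continuous functions. On the line, the
    Lagrange form makes nearby values of the quotient equal to values of the [n]-th derivative along
    [w], over the factorial, at points that tend to [q]. *)
Lemma continuous_taylor_quot n G q : smooth_on V G -> V q ->
  {for q, continuous (taylor_quot n G)}.
Proof.
move=> sG Vq; have [y0|y0] := eqVneq (y q) 0; last first.
  apply: (@Ck_on_cont _ 0 (V `&` [set q | y q != 0])) => //.
  apply: (Ck_on_eq y_neq0_open (g := fun z => taylor_rest n G z / y z ^+ n)).
    by move=> z [_ /= yz0]; rewrite /taylor_quot (negPf yz0).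
  have VV : V `&` [set q | y q != 0] `<=` V by move=> z [].
  apply: Ck_onM => //; first exact: Ck_onS VV (smooth_taylor_rest n sG 0).
  apply: Ck_onV => // [z [_ /= yz0]|]; first by rewrite expf_neq0.
  by apply: Ck_onS VV _; apply: smoothX.
apply/continuous_normP => e e0.
have sD : smooth_on V (fun z => Dw n G z / n`!%:R).
  by apply: smoothM => //; [exact: Dw_smooth|exact: smooth_cst].
have /continuous_normP/(_ e e0)[d d0 Hd] := smooth_cont sD Vq.
have W0 : 0 < `|w| + 1 by rewrite ltr_wpDl.
(* Half of [d] is reserved for the distance from [z] to [q], the other half for the displacement
   along [w]. *)
have e1 : 0 < d / 2 / (`|w| + 1) by rewrite !divr_gt0.
have /continuous_normP/(_ _ e1)[d1 d10 Hd1] := Ck_on_cont (@smooth_y 0) Vq.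
have /near_normP[r r0 Hr] := near_open oV Vq (fun z Vz => Vz).
exists (Num.min r (Num.min d1 (d / 2))).
  by rewrite !lt_min r0 d10 divr_gt0.
move=> z; rewrite !lt_min => /and3P[/Hr Vz /Hd1 yz zq].
have [t /andP[t0 t1] ->] := taylor_quot_lagrange n sG Vz.
rewrite {1}/taylor_quot y0 eqxx; apply: Hd; rewrite addrAC.
apply: le_lt_trans (ler_normB _ _) _; rewrite (splitr d).
apply: ltrD => //; rewrite y0 subr0 in yz; rewrite normrZ normrM.
have tw : `|t| * `|y z| * `|w| <= `|y z| * (`|w| + 1).
  rewrite ger0_norm// -mulrA; apply: le_trans (ler_piMl _ t1) _.
    by rewrite mulr_ge0.
  by rewrite ler_wpM2l// lerDl.
apply: le_lt_trans tw _; by rewrite -ltr_pdivlMr.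
Qed.

(** The right-hand side contains only Taylor quotients: no division by [y] is left. Off the line
    [y = 0] it is the quotient rule, on the line it comes from [taylor_quot_step]. *)
Lemma is_derive_taylor_quot n G q v : smooth_on V G -> V q ->
  is_derive q v (taylor_quot n G)
    (taylor_quot n (fun z => 'D_(v - dot l v *: w) G z) q + dot l v *
     (taylor_quot n (fun z => 'D_w G z) q - n%:R * taylor_quot n.+1 G q)).
Proof.
move=> sG Vq; set v' := v - dot l v *: w.
have sG' u : smooth_on V (fun z => 'D_u G z) by exact: smooth_derive.
have [y0|y0] := eqVneq (y q) 0.
  pose r := taylor_quot n.+1 G.
  have dyr : is_derive q v (fun z => y z * r z) (dot l v * r q).
    rewrite -(@derive_val _ _ _ _ _ _ _ (derive_y q v)).
    by apply: is_derive_mul0 => //; exact: continuous_taylor_quot.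
  have dD : derivable (fun z => Dw n G (proj z)) q v.
    by apply: smooth_derivable Vq; exact: smooth_Dw_proj.
  have dD' : derivable (fun z => Dw n G (proj z) / n`!%:R) q v.
    by apply: (@derivable_mulf _ _ _ (fun _ => _)) => //; exact: derivable_cst.
  have E : \forall z \near q,
      Dw n G (proj z) / n`!%:R + y z * r z = taylor_quot n G z.
    by apply: (near_open oV Vq) => z Vz; rewrite -taylor_quot_step.
  apply: (near_eq_is_derive E); apply: DeriveDef.
    by apply: derivable_addf => //; exact: (@ex_derive _ _ _ _ _ _ _ dyr).
  rewrite derive_addf//.
  rewrite (@derive_val _ _ _ _ _ _ _ dyr) derive_mulfr// derive_Dw_proj//.
  rewrite proj_id// -/v' Dw_comm// /r /taylor_quot y0 eqxx; congr (_ + _ * _).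
  have -> : Dw n (fun z => 'D_w G z) q = Dw n.+1 G q by rewrite /Dw iterSr.
  have alg (a f m : R) : f != 0 -> m + 1 != 0 ->
    a / ((m + 1) * f) = a / f - m * (a / ((m + 1) * f)).
    by move=> f0 m0; field; rewrite f0 m0.
  rewrite factS natrM -(natr1 n).
  by apply: alg; rewrite ?natr1 pnatr_eq0// -lt0n fact_gt0.
have dR : derivable (taylor_rest n G) q v.
  by apply: smooth_derivable Vq; exact: smooth_taylor_rest.
have dyn : derivable (fun z => y z ^+ n) q v by exact: derivable_expf.
have yn0 : y q ^+ n != 0 by rewrite expf_neq0.
have dV : derivable (fun z => (y z ^+ n)^-1) q v by exact: derivable_invf.
apply: (near_eq_is_derive (taylor_quot_near n G Vq y0)); apply: DeriveDef.
  exact: derivable_mulf.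
rewrite derive_mulf// derive_invf// derive_expf//.
rewrite (@derive_val _ _ _ _ _ _ _ (derive_y q v)).
rewrite /taylor_quot (negPf y0); case: n {dR dyn yn0 dV} => [|m].
  rewrite !expr0 invr1 !mulr1 !mul0r mulr0 mulr0 addr0 subr0 /=.
  have dG : differentiable G q by exact: smooth_diff sG Vq.
  by rewrite !deriveE// /v' linearB linearZ/= [_ *: _]/GRing.scale/=; ring.
rewrite derive_taylor_rest// -/v' [taylor_rest m.+2 G]/=.
rewrite [taylor_rest m.+1 (fun z => 'D_w G z)]/=.
have -> : Dw m (fun z => 'D_w G z) (proj q) = Dw m.+1 G (proj q).
  by rewrite /Dw iterSr.
rewrite -[taylor_rest m G q - _]/(taylor_rest m.+1 G q).
have alg (T' L P D Y T F N Q : R) : Y != 0 -> T != 0 -> F != 0 -> N != 0 ->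
  (T' + L * P) * (Y * T)^-1 + Q * (- (Y * T) ^- 2 * (N * T * L)) =
  T' / (Y * T) + L * ((P - T / F * D) / (Y * T)
    - N * ((Q - Y * T / (N * F) * D) / (Y * (Y * T)))).
  by move=> Y0 T0 F0 N0; field; rewrite Y0 T0 F0 N0.
rewrite factS natrM !(exprS (y q)).
by apply: alg; rewrite ?expf_neq0// pnatr_eq0// -lt0n fact_gt0.
Qed.

(** Induction on the order of regularity, for all [n] and [G] together, since a derivative involves
    the quotient of order [n.+1] and the derivatives of [G]. *)
Lemma smooth_taylor_quot n G : smooth_on V G -> smooth_on V (taylor_quot n G).
Proof.
move=> sG k; elim: k n G sG => [|k IH] n G sG.
  by move=> q Vq; exact: continuous_taylor_quot.
have sG' u : smooth_on V (fun z => 'D_u G z) by exact: smooth_derive.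
apply: Ck_on_partials => // [q v Vq|v].
  exact: (@ex_derive _ _ _ _ _ _ _ (is_derive_taylor_quot n v sG Vq)).
apply: (Ck_on_eq oV (g := fun q =>
  taylor_quot n (fun z => 'D_(v - dot l v *: w) G z) q + dot l v *
     (taylor_quot n (fun z => 'D_w G z) q - n%:R * taylor_quot n.+1 G q))).
  move=> q Vq; rewrite (@derive_val _ _ _ _ _ _ _ (is_derive_taylor_quot n v sG Vq)).
  by [].
apply: Ck_onD => //; first exact: IH.
apply: Ck_onM => //; first exact: Ck_on_cst.
apply: Ck_onB => //; first exact: IH.
by apply: Ck_onM => //; [exact: Ck_on_cst|exact: IH].
Qed.

Lemma smooth_taylor n G : smooth_on V G ->
  exists r : 'rV[R]_2 -> R, [/\ smooth_on V r,
    forall q, V q -> G q =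
      \sum_(k < n) dot l (q - p) ^+ k / k`!%:R *
        iter k (fun g z => 'D_w g z) G (q - dot l (q - p) *: w)
      + dot l (q - p) ^+ n * r q
    & forall q, dot l (q - p) = 0 ->
      r q = iter n (fun g z => 'D_w g z) G q / n`!%:R].
Proof.
move=> sG; exists (taylor_quot n G); split=> [|q Vq|q yq].
- exact: smooth_taylor_quot.
- rewrite -[_ ^+ n * _]taylor_rest_quot; elim: (n) => [|m IH].
    by rewrite big_ord0 add0r.
  by rewrite big_ord_recr /= -addrA [X in _ + X]addrC subrK.
- by rewrite /taylor_quot /y yq eqxx.
Qed.

End taylor_remainder.

(** * Inverse function theorem *)

(** The Banach fixed point theorem asks for a complete normed module. *)
HB.instance Definition _ (R : realType) (m n : nat) :=
  Complete.on 'M[R]_(m, n).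

Section inverse_function.
Context {R : realType}.
Implicit Types (U V W : set 'rV[R]_2) (p q v : 'rV[R]_2).

(** The closed ball of radius [r] is mapped into itself: the contraction accounts for [r / 2] and
    the displacement of the centre for the other half. *)
Lemma contraction_fixed (E : 'rV[R]_2 -> 'rV[R]_2) p z (r : R) : 0 < r ->
  (forall q1 q2, `|q1 - p| <= r -> `|q2 - p| <= r ->
     `|E q1 - E q2| <= 2^-1 * `|q1 - q2|) ->
  `|E p + z - p| <= r / 2 ->
  exists2 q, `|q - p| <= r & q = E q + z.
Proof.
move=> r0 cE Ep; pose A : set 'rV[R]_2 := [set q | `|q - p| <= r].
have AA : {homo (fun q => E q + z) : q / A q >-> A q}.
  move=> q Aq; rewrite /A/=.
  have -> : E q + z - p = (E q - E p) + (E p + z - p).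
    by rewrite addrA addrA subrK.
  rewrite (le_trans (ler_normD _ _))// [r]splitr lerD//.
  have := cE q p Aq; rewrite subrr normr0 => /(_ (ltW r0)) /le_trans; apply.
  by rewrite mulrC ler_wpM2r// invr_ge0.
have h2 : (0 : R) <= 2^-1 by rewrite invr_ge0.
have [| | |q Aq Eq] := @banach_fixed_point R 'rV[R]_2 A (mkfun AA).
- exists (NngNum h2); split; first by rewrite /= invf_lt1// ltr1n.
  move=> [q1 q2] [/= A1 A2]; rewrite /mkfun /= opprD addrACA subrr addr0.
  exact: cE.
- have -> : A = (fun q => `|q - p|) @^-1` [set x : R | x <= r] by [].
  apply: preimage_closed; last exact: closed_le.
  move=> q _; apply: (@continuous_comp _ _ _ (fun q => q - p) Num.norm).
    by apply: continuousB; [exact: cvg_id|exact: cst_continuous].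
  exact: norm_continuous.
- by exists p; rewrite /A/= subrr normr0 ltW.
- by exists q.
Qed.

Let quarter_sum (a b x y n : R) : 0 <= x -> 0 <= y -> 0 <= a -> 0 <= b ->
  a <= n -> b <= n -> x <= 4^-1 -> y <= 4^-1 -> a * x + b * y <= 2^-1 * n.
Proof. by nra. Qed.

Let convex_lt (t a b r : R) : 0 <= t -> t <= 1 -> a < r -> b < r ->
  t * a + (1 - t) * b < r.
Proof.
move=> t0 t1 ar br; have [tp|tn] := ltP 0 t.
  have : 0 < t * (r - a) by rewrite mulr_gt0// subr_gt0.
  have : 0 <= (1 - t) * (r - b) by rewrite mulr_ge0// subr_ge0// ltW.
  by lra.
have -> : t = 0 by apply/eqP; rewrite eq_le tn.
by rewrite mul0r add0r subr0 mul1r.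
Qed.

(** In the sup norm each coordinate of [v] is at most its norm, so two partial derivatives bounded
    by [4^-1] add up to the factor [2^-1]. *)
Lemma small_derive (E : 'rV[R]_2 -> R) q v : differentiable E q ->
  (forall k, `|'D_(delta_mx 0 k) E q| <= 4^-1) -> `|'D_v E q| <= 2^-1 * `|v|.
Proof.
move=> dE bE; rewrite derive_basis// big_ord_recl big_ord1.
rewrite (_ : lift _ _ = 1); last exact: val_inj.
apply: le_trans (ler_normD _ _) _; rewrite !normrZ.
by apply: quarter_sum => //; exact: norm_rv2_ge.
Qed.

(** The mean value theorem is applied to each component along the segment, with its own intermediate
    point; the sup norm then reassembles the components. *)
Lemma small_derive_lipschitz (E : 'rV[R]_2 -> 'rV[R]_2) p (r : R) :
  (forall q, `|q - p| < r -> differentiable E q) ->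
  (forall q j k, `|q - p| < r ->
     `|'D_(delta_mx 0 k) (fun z => E z 0 j) q| <= 4^-1) ->
  forall q1 q2, `|q1 - p| < r -> `|q2 - p| < r ->
    `|E q1 - E q2| <= 2^-1 * `|q1 - q2|.
Proof.
move=> dE bE q1 q2 h1 h2.
have seg (t : R) : 0 <= t <= 1 -> `|q2 + t *: (q1 - q2) - p| < r.
  move=> /andP[t0 t1].
  have -> : q2 + t *: (q1 - q2) - p = t *: (q1 - p) + (1 - t) *: (q2 - p).
    by apply/rowP => j; rewrite !mxE; ring.
  apply: le_lt_trans (ler_normD _ _) _; rewrite !normrZ.
  rewrite !ger0_norm ?subr_ge0//.
  exact: convex_lt.
have comp j : `|(E q1 - E q2) 0 j| <= 2^-1 * `|q1 - q2|.
  have dEj q : `|q - p| < r -> differentiable (fun z => E z 0 j) q.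
    by move=> /dE /differentiable_coordP; exact.
  have [t t01|t /andP[t0 t1]] := @mvt_line R 2 (fun z => E z 0 j) q2 (q1 - q2).
    by apply: diff_derivable; apply: dEj; exact: seg.
  rewrite !mxE (addrC q2) subrK => ->; apply: small_derive.
    by apply: dEj; apply: seg; rewrite !ltW.
  by move=> k; apply: bE; apply: seg; rewrite !ltW.
by apply: norm_rv2_le; exact: comp.
Qed.

Lemma unitmx_inj n (J : 'M[R]_n) :
  (forall v : 'rV[R]_n, v *m J = 0 -> v = 0) -> J \in unitmx.
Proof.
move=> H; rewrite -row_free_unit -kermx_eq0; apply/rowV0P => v.
by move=> /sub_kermxP /H.
Qed.

Lemma continuous_mulmxr (A : 'M[R]_2) : continuous (mulmxr A : 'rV[R]_2 -> 'rV[R]_2).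
Proof.
suff H : Ck_on 0 setT (fun q : 'rV[R]_2 => q *m A) by move=> q; exact: (H q I).
apply/(Ck_on_coordP _ _ openT) => j.
apply: Ck_on_mulmx; [exact: openT|move=> i k|by move=> i k; exact: Ck_on_cst].
by rewrite (ord1 i); exact: smooth_coord.
Qed.

Lemma derive_mulmxr (g : 'rV[R]_2 -> 'rV[R]_2) (A : 'M[R]_2) q v :
  differentiable g q ->
  differentiable (fun z => g z *m A) q /\
  'D_v (fun z => g z *m A) q = 'D_v g q *m A.
Proof.
move=> dg; have dA x : differentiable (mulmxr A : 'rV[R]_2 -> 'rV[R]_2) x.
  by apply: linear_differentiable; exact: continuous_mulmxr.
split; first exact: (@differentiable_comp _ _ _ _ g (mulmxr A)).
rewrite (derive_comp v dg (dA _)) deriveE// diff_lin//.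
exact: continuous_mulmxr.
Qed.

Lemma jacobian_entry (g : 'rV[R]_2 -> 'rV[R]_2) q i j : differentiable g q ->
  jacobian g q i j = 'D_(delta_mx 0 i) (fun z => g z 0 j) q.
Proof.
move=> dg; rewrite -derive_coord; last exact: diff_derivable.
by rewrite deriveEjacobian// -rowE [RHS]mxE.
Qed.

Lemma jacobian_unit (g : 'rV[R]_2 -> 'rV[R]_2) q : differentiable g q ->
  (forall v, 'D_v g q = 0 -> v = 0) -> jacobian g q \in unitmx.
Proof.
by move=> dg H; apply: unitmx_inj => v; rewrite -deriveEjacobian//; exact: H.
Qed.

(** The Lipschitz bound converts the linearisation error of [Phi] into one for [psi], whose
    differential at [z] is thus the inverse Jacobian of [Phi] at [psi z]. This expresses the
    derivative of [psi] through [psi], so regularity of order [k] gives order [k.+1]. *)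
Lemma smooth_inverse U W (Phi psi : 'rV[R]_2 -> 'rV[R]_2) : open U -> open W ->
  smooth_on U Phi -> (forall q, U q -> jacobian Phi q \in unitmx) ->
  (forall z, W z -> U (psi z) /\ Phi (psi z) = z) ->
  (exists2 C : R, 0 < C & forall z1 z2, W z1 -> W z2 ->
     `|psi z1 - psi z2| <= C * `|z1 - z2|) ->
  smooth_on W psi.
Proof.
move=> oU oW sPhi uJ inv [C C0 lip].
pose N z := invmx (jacobian Phi (psi z)).
have dpsi z : W z -> is_diff z psi (mulmxr (N z)).
  move=> Wz; have [Uq Ez] := inv z Wz; set q := psi z in Uq Ez *.
  have dPhi := smooth_diff sPhi Uq.
  apply: eps_is_diff => [|e e0]; first exact: continuous_mulmxr.
  have [K K0 HK] := linear_lipschitz (@continuous_mulmxr (N z)).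
  have e1 : 0 < e / (K * C) by rewrite divr_gt0// mulr_gt0.
  have /near_normP[d d0 Hd] := diff_eps dPhi e1.
  have /near_normP[r r0 Hr] := near_open oW Wz (fun z Wz => Wz).
  apply/near_normP; exists (Num.min r (d / C)) => [|z'].
    by rewrite lt_min r0 divr_gt0.
  rewrite lt_min => /andP[/Hr Wz' zd].
  have [Uq' Ez'] := inv z' Wz'; set q' := psi z' in Uq' Ez' *.
  have lq := lip _ _ Wz' Wz; rewrite -/q -/q' in lq.
  have qd : `|q' - q| < d.
    by apply: le_lt_trans lq _; rewrite mulrC -ltr_pdivlMr.
  have := Hd _ qd; rewrite Ez Ez' -deriveE// deriveEjacobian// => {}Hd.
  (* The error of [psi] is minus the image under [N z] of the error of [Phi]; the constant [K]
     bounds [N z] and [C] is the Lipschitz constant, hence the tolerance [e / (K * C)]. *)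
  have -> : q' - q - mulmxr (N z) (z' - z) =
      - mulmxr (N z) (z' - z - (q' - q) *m jacobian Phi q).
    rewrite /= [in RHS]mulmxBl -[X in _ = - (_ - X)]mulmxA.
    by rewrite mulmxV ?uJ// mulmx1 opprB.
  rewrite normrN; apply: le_trans (HK _) _.
  have KC : K * (e / (K * C) * (C * `|z' - z|)) = e * `|z' - z|.
    by field; rewrite !gt_eqF.
  rewrite -KC ler_pM2l//; apply: le_trans Hd _.
  by rewrite ler_pM2l.
have dpsi' z : W z -> differentiable psi z.
  by move=> /dpsi; exact: (@ex_diff _ _ _ _ _ _ _).
move=> k; elim: k => [|k IH].
  by move=> z Wz; apply: differentiable_continuous; exact: dpsi'.
split=> // v; apply/Ck_on_coordP => // j.
apply: (Ck_on_eq oW (g := fun z => (v *m N z) 0 j)) => [z Wz|].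
  by rewrite (deriveE v (dpsi' z Wz)) (@diff_val _ _ _ _ _ _ _ (dpsi z Wz)).
apply: Ck_on_mulmx => // [i l|i l]; first exact: Ck_on_cst.
apply: Ck_on_invmx => // [z /inv[/uJ]//|i' l'].
apply: (Ck_on_eq oW (g := fun z =>
    (fun q => 'D_(delta_mx 0 i') (fun z => Phi z 0 l') q) (psi z))) => [z Wz|].
  by rewrite jacobian_entry//; apply: smooth_diff sPhi _; case: (inv z Wz).
apply: (@Ck_on_comp _ k U W psi
  (fun q => 'D_(delta_mx 0 i') (fun z => Phi z 0 l') q)) => //.
  by move=> z /inv[].
by apply: smooth_derive; move/(smooth_coordP _ oU) : sPhi; exact.
Qed.

(** After composing with the inverse Jacobian at [p], the map [Psi] has the identity as differential
    at [p], so [E], the identity minus [Psi], contracts near [p]. Solving [Phi q = z] is then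
    finding a fixed point of [E] translated by [z *m A]. *)
Lemma inverse_function U (Phi : 'rV[R]_2 -> 'rV[R]_2) p : open U -> U p ->
  smooth_on U Phi -> (forall v, 'D_v Phi p = 0 -> v = 0) ->
  exists V W (psi : 'rV[R]_2 -> 'rV[R]_2),
    [/\ V `<=` U, V p & diffeomorphism V W Phi psi].
Proof.
move=> oU Up sPhi injp.
have uJ : jacobian Phi p \in unitmx.
  by apply: jacobian_unit => //; exact: smooth_diff sPhi Up.
pose A := invmx (jacobian Phi p); pose Psi q := Phi q *m A.
pose E q := q - Psi q.
have dPsi q v : U q -> differentiable Psi q /\ 'D_v Psi q = 'D_v Phi q *m A.
  by move=> Uq; apply: derive_mulmxr; exact: smooth_diff sPhi Uq.
have sEj j : smooth_on U (fun q => E q 0 j).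
  apply: (smooth_on_eq oU (g := fun q => q 0 j - \sum_k Phi q 0 k * A k j)).
    by move=> q _; rewrite !mxE.
  apply: smoothB => // [|n]; first exact: smooth_coord.
  apply: Ck_on_sum => // k; apply: Ck_onM => //; last exact: Ck_on_cst.
  by move: n; move/(smooth_coordP _ oU) : sPhi; exact.
have dE q v : U q -> differentiable E q /\ 'D_v E q = v - 'D_v Phi q *m A.
  move=> Uq; have [dP <-] := dPsi q v Uq.
  have dE : differentiable E q.
    by apply/differentiable_coordP => j; exact: smooth_diff (sEj j) Uq.
  split=> //; apply/rowP => j; rewrite derive_coord; last exact: diff_derivable.
  rewrite !mxE derive_coord; last exact: diff_derivable.
  rewrite -[in RHS](derive_id_coord q v) -[RHS]derive_subf.
  - by congr ('D_v _ q); apply/funext => z; rewrite !mxE.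
  - exact: smooth_derivable (@smooth_coord _ U _) Uq.
  - by apply: diff_derivable; move/differentiable_coordP : dP; exact.
have E0 j k : 'D_(delta_mx 0 k) (fun z => E z 0 j) p = 0.
  have [dEp] := dE p (delta_mx 0 k) Up.
  rewrite (@deriveEjacobian _ _ _ Phi p _ (smooth_diff sPhi Up)) /A mulmxK//.
  rewrite subrr => D0.
  by rewrite -derive_coord ?D0 ?mxE//; exact: diff_derivable.
have [r r0 Hr] : exists2 r : R, 0 < r & forall q, `|q - p| < r ->
    U q /\ forall j k, `|'D_(delta_mx 0 k) (fun z => E z 0 j) q| <= 4^-1.
  apply/near_normP; have small : \forall q \near p, forall jk : 'I_2 * 'I_2,
      `|'D_(delta_mx 0 jk.2) (fun z => E z 0 jk.1) q| <= 4^-1.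
    apply: (@filter_forall _ _ _ _ (nbhs_filter p)) => -[j k] /=; have q0 : 0 < 4^-1 :> R by [].
    have cD := smooth_cont (smooth_derive (delta_mx 0 k) (sEj j)) Up.
    have /continuous_normP/(_ _ q0)[d d0 Hd] := cD.
    suff : \forall q \near p, `|'D_(delta_mx 0 k) (fun z => E z 0 j) q| <= 4^-1 by [].
    by apply/near_normP; exists d => // q /Hd; rewrite E0 subr0 => /ltW.
  apply: filterS2 (near_open oU Up (fun q Uq => Uq)) small => q Uq Hq.
  by split=> // j k; exact: (Hq (j, k)).
have lipE q1 q2 : `|q1 - p| < r -> `|q2 - p| < r ->
    `|E q1 - E q2| <= 2^-1 * `|q1 - q2|.
  apply: small_derive_lipschitz => [q /Hr[Uq _]|q j k /Hr[_]]; last exact.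
  by have [] := dE q 0 Uq.
have lipPsi q1 q2 : `|q1 - p| < r -> `|q2 - p| < r ->
    `|q1 - q2| <= 2 * `|Psi q1 - Psi q2|.
  move=> h1 h2; have := lipE q1 q2 h1 h2.
  have : `|q1 - q2| <= `|E q1 - E q2| + `|Psi q1 - Psi q2|.
    have -> : q1 - q2 = (E q1 - E q2) + (Psi q1 - Psi q2).
      rewrite /E; move: (Psi q1) (Psi q2) => a b.
      by apply/rowP => j; rewrite !mxE; ring.
    exact: ler_normD.
  by lra.
(* If ['D_v Phi q] vanishes then ['D_v E q] is [v], whereas the small partial derivatives of [E]
   bound it by half the norm of [v]. *)
have injPhi q v : `|q - p| < r -> 'D_v Phi q = 0 -> v = 0.
  move=> qr D0; have [Uq bq] := Hr q qr; have [dEq] := dE q v Uq.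
  rewrite D0 mul0mx subr0 => Ev.
  have hv : `|v| <= 2^-1 * `|v|.
    have hj j : `|v 0 j| <= 2^-1 * `|v|.
      have -> : v 0 j = 'D_v (fun z => E z 0 j) q.
        by rewrite -derive_coord ?Ev//; exact: diff_derivable.
      by apply: small_derive => //; move/differentiable_coordP : dEq; exact.
    by apply: norm_rv2_le.
  by apply/eqP; rewrite -normr_le0; lra.
pose B : set 'rV[R]_2 := [set q | `|q - p| < r].
have oB : open B.
  have -> : B = ball p r.
    by apply/seteqP; split=> q; rewrite /B -ball_normE /= distrC.
  exact: ball_open.
have BU : B `<=` U by move=> q /Hr[].
(* [W] consists of the values for which the fixed point argument applies, and [V] is the preimage of
   [W] in the ball [B]. *)
pose V : set 'rV[R]_2 := [set q | `|q - p| < r /\ `|Psi q - Psi p| < r / 4].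
pose W : set 'rV[R]_2 := [set z | `|z *m A - Psi p| < r / 4].
have r40 : 0 < r / 4 by rewrite divr_gt0.
have oW : open W.
  have -> : W = (fun z => z *m A) @^-1` ball (Psi p) (r / 4).
    by apply/seteqP; split=> z; rewrite /W -ball_normE /= distrC.
  apply: open_comp; last exact: ball_open.
  by move=> z _; exact: continuous_mulmxr.
have oV : open V.
  rewrite openE => q [qr qV].
  have cPsi := differentiable_continuous (dPsi q 0 (BU q qr)).1.
  have gap : 0 < r / 4 - `|Psi q - Psi p| by rewrite subr_gt0.
  have /continuous_normP/(_ _ gap)[d d0 Hd] := cPsi.
  have nd : \forall z \near q, `|z - q| < d by apply/near_normP; exists d.
  apply: filterS2 (near_open oB qr (fun q Bq => Bq)) nd => z zr /Hd zd.
  split=> //; rewrite -(subrK (Psi q) (Psi z)) -addrA.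
  by apply: le_lt_trans (ler_normD _ _) _; rewrite -ltrBrDr.
have sol z : W z -> exists2 q, `|q - p| < r & Phi q = z.
  (* The closed ball of radius [r / 2] stays inside the open ball where [E] contracts; half of that
     radius is the [r / 4] in [W]. *)
  move=> Wz; have r20 : 0 < r / 2 by rewrite divr_gt0.
  have r2r : r / 2 < r by rewrite ltr_pdivrMr// mulr_natr mulr2n ltrDl.
  have [q1 q2 h1 h2||q qr Eq] := @contraction_fixed E p (z *m A) (r / 2) r20.
  - by apply: lipE; [exact: le_lt_trans h1 r2r|exact: le_lt_trans h2 r2r].
  - have -> : E p + z *m A - p = z *m A - Psi p.
      rewrite /E; move: (Psi p) (z *m A) => a b.
      by apply/rowP => j; rewrite !mxE; ring.
    by rewrite -mulrA -invfM -natrM ltW.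
  exists q; first exact: le_lt_trans qr r2r.
  have : Psi q = z *m A.
    move: Eq; rewrite /E; move: (Psi q) (z *m A) => a b /rowP Eq.
    by apply/rowP => j; have := Eq j; rewrite !mxE; lra.
  by apply: (can_inj (mulmxK _)); rewrite unitmx_inv.
(* On [W] the set of solutions is inhabited, so the default value [p] can occur only outside [W]. *)
pose psi z := xget p [set q | `|q - p| < r /\ Phi q = z].
have psiP z : W z -> `|psi z - p| < r /\ Phi (psi z) = z.
  move=> /sol[q qr Eq].
  apply: (@xgetPex _ p [set q | `|q - p| < r /\ Phi q = z]).
  by exists q; split.
have PsiW z : Psi z = Phi z *m A by [].
exists V, W, psi; split.
- by move=> q [/BU].
- by split; rewrite subrr normr0.
split=> //.
- by apply: smooth_onS sPhi => q [/BU].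
- have uB q : B q -> jacobian Phi q \in unitmx.
    move=> qr; apply: jacobian_unit => [|v]; last exact: injPhi.
    by apply: smooth_diff sPhi _; exact: BU.
  have lipW : exists2 C : R, 0 < C & forall z1 z2, W z1 -> W z2 ->
      `|psi z1 - psi z2| <= C * `|z1 - z2|.
    have [K K0 HK] := linear_lipschitz (@continuous_mulmxr A).
    exists (2 * K) => [|z1 z2 /psiP[r1 E1] /psiP[r2 E2]]; first by rewrite mulr_gt0.
    apply: le_trans (lipPsi _ _ r1 r2) _; rewrite -mulrA ler_pM2l//.
    by rewrite !PsiW E1 E2 -mulmxBl; exact: HK.
  exact: smooth_inverse oB oW (smooth_onS BU sPhi) uB psiP lipW.
- split=> [q [qr qV]|z Wz].
    split; first by rewrite /W/= -PsiW.
    have Wq : W (Phi q) by rewrite /W/= -PsiW.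
    have [r1 E1] := psiP _ Wq.
    apply/eqP; rewrite -subr_eq0 -normr_le0; apply: le_trans (lipPsi _ _ r1 qr) _.
    by rewrite !PsiW E1 subrr normr0 mulr0.
  have [r1 E1] := psiP _ Wz; split=> //; split=> //.
  by rewrite PsiW E1.
Qed.

End inverse_function.

(** * Normal form of a cubic fold *)

Section cubic_fold.
Context {R : realType}.
Implicit Types (U V : set 'rV[R]_2) (G : 'rV[R]_2 -> R) (p q e w v : 'rV[R]_2).

Lemma open_pos V (f : 'rV[R]_2 -> R) : open V ->
  (forall q, V q -> {for q, continuous f}) -> open [set q | V q /\ 0 < f q].
Proof.
move=> oV cf; rewrite openE => q [Vq fq].
have /continuous_normP/(_ _ fq)[d d0 Hd] := cf q Vq.
have nd : \forall z \near q, `|z - q| < d by apply/near_normP; exists d.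
apply: filterS2 (near_open oV Vq (fun z Vz => Vz)) nd => z Vz /Hd zd.
by split=> //; move: zd; rewrite ltr_norml => /andP[]; lra.
Qed.

(** The dual basis is given by Cramer's rule, [D] being the determinant of [e] and [w]. *)
Lemma dual_basis e w : e 0 0 * w 0 1 - e 0 1 * w 0 0 != 0 ->
  exists lx ly : 'rV[R]_2,
    [/\ dot lx e = 1, dot lx w = 0, dot ly e = 0, dot ly w = 1 &
      forall v, v = dot lx v *: e + dot ly v *: w].
Proof.
set D := _ - _ => D0.
have dotE (a b : 'rV[R]_2) : dot a b = a 0 0 * b 0 0 + a 0 1 * b 0 1.
  rewrite /dot big_ord_recl big_ord1 (_ : lift _ _ = 1)//; exact: val_inj.
pose row2 (a b : R) : 'rV[R]_2 := \row_j (if j == 0 then a else b).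
have row20 a b : row2 a b 0 0 = a by rewrite mxE.
have row21 a b : row2 a b 0 1 = b by rewrite mxE.
exists (row2 (w 0 1 / D) (- w 0 0 / D)), (row2 (- e 0 1 / D) (e 0 0 / D)).
split=> [||||v]; rewrite !dotE ?row20 ?row21.
- by rewrite -[RHS](mulfV D0) {3}/D; ring.
- by ring.
- by ring.
- by rewrite -[RHS](mulfV D0) {3}/D; ring.
rewrite [LHS]rv2_decomp [RHS]rv2_decomp; congr (_ *: _ + _ *: _);
  rewrite !mxE -[LHS]mulr1 -(mulfV D0) {1}/D; ring.
Qed.

Let cbrtK (a : R) : 0 < a -> (a `^ 3^-1) ^+ 3 = a.
Proof.
by move=> a0; rewrite -powR_mulrn ?powR_ge0// -powRrM mulVf// powRr1// ltW.
Qed.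

Let sqrtK (a : R) : 0 < a -> (a `^ 2^-1) ^+ 2 = a.
Proof.
by move=> a0; rewrite -powR_mulrn ?powR_ge0// -powRrM mulVf// powRr1// ltW.
Qed.

Let sign_pos (a : R) : a != 0 -> 0 < (-1) ^+ (a < 0)%R * a.
Proof. by move=> a0; rewrite -normrEsign normr_gt0. Qed.

Let weighted_lt (a b n1 n2 m : R) : 0 <= n1 -> 0 <= n2 -> 0 < m -> a < m -> b < m ->
  a * n1 + b * n2 < m * (n1 + n2 + 1).
Proof.
move=> h1 h2 m0 am bm.
have : 0 <= (m - a) * n1 by rewrite mulr_ge0// subr_ge0 ltW.
have : 0 <= (m - b) * n2 by rewrite mulr_ge0// subr_ge0 ltW.
by lra.
Qed.

Let sum2 (a : R) (c : nat -> R) :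
  \sum_(k < 2) a ^+ k / k`!%:R * c k = c 0%N + a * c 1%N.
Proof. by rewrite !big_ord_recr big_ord0 /= !divr1 add0r mul1r expr1. Qed.

Let sum3 (a : R) (c : nat -> R) :
  \sum_(k < 3) a ^+ k / k`!%:R * c k = c 0%N + a * c 1%N + a ^+ 2 / 2 * c 2%N.
Proof. by rewrite big_ord_recr/= sum2. Qed.

(** Expanding to order two across the line [y = 0] leaves two functions on that line, the values of
    [G] and of ['D_w G]. They are expanded along the line to orders three and two, and the vanishing
    derivatives at [p] remove the lower coefficients. *)
Lemma cubic_expansion U G p e w lx ly : open U -> U p -> smooth_on U G ->
  dot lx e = 1 -> dot lx w = 0 -> dot ly e = 0 -> dot ly w = 1 ->
  (forall v, v = dot lx v *: e + dot ly v *: w) ->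
  'D_e G p = 0 -> 'D_w G p = 0 ->
  'D_e (fun z => 'D_e G z) p = 0 -> 'D_e (fun z => 'D_w G z) p = 0 ->
  exists V (a b c : 'rV[R]_2 -> R),
    [/\ open V /\ V p, smooth_on V a /\ smooth_on V b /\ smooth_on V c,
      a p = 'D_e (fun z => 'D_e (fun z => 'D_e G z) z) p / 6,
      c p = 'D_w (fun z => 'D_w G z) p / 2 &
      forall q, V q -> let x := dot lx (q - p) in let y := dot ly (q - p) in
        G q = G p + x ^+ 3 * a q + x ^+ 2 * y * b q + y ^+ 2 * c q].
Proof.
move=> oU Up sG lxe lxw lye lyw dec Ge Gw Gee Gew.
pose x q := dot lx (q - p); pose y q := dot ly (q - p).
have /near_normP[r r0 Hr] := near_open oU Up (fun q Uq => Uq).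
(* A parallelogram with sides along [e] and [w] is star-shaped towards both axes; the bound [r / N]
   on its coordinates puts it inside the ball of radius [r]. *)
pose N := `|e| + `|w| + 1.
have N0 : 0 < N by rewrite ltr_wpDl// addr_ge0.
pose V : set 'rV[R]_2 := [set q | `|x q| < r / N /\ `|y q| < r / N].
have VU : V `<=` U.
  move=> q [xq yq]; apply: Hr; rewrite (dec (q - p)) -/(x q) -/(y q).
  apply: le_lt_trans (ler_normD _ _) _; rewrite !normrZ.
  have rN0 : 0 < r / N by exact: divr_gt0.
  have := weighted_lt (normr_ge0 e) (normr_ge0 w) rN0 xq yq.
  by rewrite -/N divfK// gt_eqF.
have cl l : continuous (fun q => dot l (q - p)).
  move=> q; suff H : Ck_on 0 setT (fun q => dot l (q - p)) by exact: (H q I).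
  apply: Ck_on_dot; [exact: openT|exact: Ck_on_cst|].
  by apply: Ck_onD; [exact: openT|exact: Ck_on_id|exact: Ck_on_cst].
have oV : open V.
  have -> : V = x @^-1` ball 0 (r / N) `&` y @^-1` ball 0 (r / N).
    by apply/seteqP; split=> q; rewrite /V/= -ball_normE /= !sub0r !normrN.
  by apply: openI; apply: open_comp; try exact: ball_open; move=> q _; exact: cl.
have Vp : V p by rewrite /V/= /x /y subrr !dot0r normr0; split; exact: divr_gt0.
have xZ q a v : x (q + a *: v) = x q + a * dot lx v.
  by rewrite /x addrAC (dotDr lx (q - p)) dotZr.
have yZ q a v : y (q + a *: v) = y q + a * dot ly v.
  by rewrite /y addrAC (dotDr ly (q - p)) dotZr.
have shrink (t a : R) : 0 <= t <= 1 -> `|a| < r / N -> `|a - t * a| < r / N.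
  move=> /andP[t0 t1] ha; have -> : a - t * a = (1 - t) * a by ring.
  rewrite normrM ger0_norm ?subr_ge0//; apply: le_lt_trans ha.
  by rewrite ler_piMl// gerBl.
have starw q (t : R) : V q -> 0 <= t <= 1 -> V (q - (t * y q) *: w).
  move=> [xq yq] t01; rewrite /V/= -scaleNr xZ yZ lxw lyw mulr0 addr0 mulr1.
  by split=> //; exact: shrink.
have stare q (t : R) : V q -> 0 <= t <= 1 -> V (q - (t * x q) *: e).
  move=> [xq yq] t01; rewrite /V/= -scaleNr xZ yZ lxe lye mulr0 addr0 mulr1.
  by split=> //; exact: shrink.
have sGV := smooth_onS VU sG.
(* [pw] projects onto the axis directed by [e] and [pe] onto the one directed by [w]. Their
   composite is the constant [p], so the coefficients of the expansions in [x] are numbers read at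
   [p]. *)
pose pw q := q - y q *: w; pose pe q := q - x q *: e.
have spw : smooth_on V pw := @smooth_proj R p ly w V oV.
have Vpw q : V q -> V (pw q).
  by move=> /(starw _ 1); rewrite mul1r; apply; rewrite ler01 lexx.
have Vpe q : V q -> V (pe q).
  by move=> /(stare _ 1); rewrite mul1r; apply; rewrite ler01 lexx.
have pwe q : pw (pe q) = p.
  have xq : x (pe q) = 0 by rewrite /pe -scaleNr xZ lxe mulr1 subrr.
  have := dec (pe q - p); rewrite -/(x _) -/(y _) xq scale0r add0r => E.
  by rewrite /pw -E opprB addrC subrK.
have De_pw (H : 'rV[R]_2 -> R) q : smooth_on V H -> V q ->
    'D_e (fun z => H (pw z)) q = 'D_e H (pw q).
  move=> sH Vq; rewrite (derive_comp e (smooth_diff spw Vq) (smooth_diff sH (Vpw _ Vq))).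
  by rewrite (@derive_proj R p ly w V oV q e Vq) lye scale0r subr0.
have sH (H : 'rV[R]_2 -> R) : smooth_on V H -> smooth_on V (fun q => H (pw q)).
  by move=> sH; exact: smooth_comp oV Vpw spw sH.
have [B [sB EB Bp]] := smooth_taylor lyw oV starw 2 sGV.
have [A [sA EA Ap]] := smooth_taylor lxe oV stare 3 (sH _ sGV).
have sDw := smooth_derive w sGV.
have [C [sC EC Cp]] := smooth_taylor lxe oV stare 2 (sH _ sDw).
have xp : x p = 0 by rewrite /x subrr dot0r.
have yp : y p = 0 by rewrite /y subrr dot0r.
have sDe := smooth_derive e sGV.
have sDee := smooth_derive e sDe.
have De2 q : V q -> 'D_e (fun z => 'D_e (fun z => G (pw z)) z) q =
    'D_e (fun z => 'D_e G z) (pw q).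
  move=> Vq; rewrite (derive_eq_on e oV (fun z Vz => De_pw _ _ sGV Vz) Vq).
  exact: De_pw.
have De3 q : V q -> 'D_e (fun z => 'D_e (fun z => 'D_e (fun z => G (pw z)) z) z) q =
    'D_e (fun z => 'D_e (fun z => 'D_e G z) z) (pw q).
  move=> Vq; rewrite (derive_eq_on e oV De2 Vq).
  exact: De_pw.
have f3 : 3`!%:R = 6 :> R by [].
have f2 : 2`!%:R = 2 :> R by [].
have pwp : pw p = p by rewrite /pw yp scale0r subr0.
exists V, A, C, B; split=> //.
- by rewrite (Ap _ xp) f3 /= (De3 p Vp) pwp.
- by rewrite (Bp _ yp) f2.
move=> q Vq; rewrite -/(x q) -/(y q).
have Vq' := Vpe _ Vq.
have E1 : G q = G (pw q) + y q * 'D_w G (pw q) + y q ^+ 2 * B q.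
  rewrite {1}(EB q Vq); congr (_ + _).
  exact: (sum2 _ (fun k => iter k (fun g z => 'D_w g z) G (pw q))).
have E2 : G (pw q) = G p + x q ^+ 3 * A q.
  rewrite {1}(EA q Vq); congr (_ + _).
  rewrite (sum3 _ (fun k => iter k (fun g z => 'D_e g z) (fun q => G (pw q)) (pe q))).
  rewrite [iter 0 _ _ _]/= [iter 1 _ _ _]/= [iter 2 _ _ _]/=.
  by rewrite (De_pw _ _ sGV Vq') (De2 _ Vq') pwe Ge Gee !mulr0 !addr0.
have E3 : 'D_w G (pw q) = x q ^+ 2 * C q.
  rewrite {1}(EC q Vq).
  rewrite (sum2 _ (fun k => iter k (fun g z => 'D_e g z)
    (fun q => 'D_w G (pw q)) (pe q))).
  rewrite [iter 0 _ _ _]/= [iter 1 _ _ _]/=.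
  by rewrite (De_pw _ _ sDw Vq') pwe Gw Gew mulr0 !add0r.
rewrite {1}E1 E2 E3; move: (x q) (y q) (A q) (B q) (C q) (G p) => a b c d f g.
by ring.
Qed.

Let complete_square (c y x a b : R) : c != 0 ->
  x ^+ 3 * a + x ^+ 2 * y * b + y ^+ 2 * c =
  x ^+ 3 * (a - x * (b ^+ 2 / (4 * c))) + c * (y + x * (x * (b / (2 * c)))) ^+ 2.
Proof. by move=> c0; field. Qed.

Let sign_mulK (s : bool) (a : R) : (-1) ^+ s * ((-1) ^+ s * a) = a.
Proof. by rewrite mulrA -expr2 sqrr_sign mul1r. Qed.

Lemma derive_normal_form U G p e w : open U -> U p -> smooth_on U G ->
  e 0 0 * w 0 1 - e 0 1 * w 0 0 != 0 ->
  'D_e G p = 0 -> 'D_w G p = 0 ->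
  'D_e (fun z => 'D_e G z) p = 0 -> 'D_e (fun z => 'D_w G z) p = 0 ->
  'D_w (fun z => 'D_w G z) p != 0 ->
  'D_e (fun z => 'D_e (fun z => 'D_e G z) z) p != 0 ->
  Ak_point 2 G p.
Proof.
move=> oU Up sG ew Ge Gw Gee Gew Gww Geee.
have [lx [ly [lxe lxw lye lyw dec]]] := dual_basis ew.
have [V [a [b [c [[oV Vp] [sa [sb sc]] ap cp EG]]]]] :=
  cubic_expansion oU Up sG lxe lxw lye lyw dec Ge Gw Gee Gew.
pose x q := dot lx (q - p); pose y q := dot ly (q - p).
have sxy l W : open W -> smooth_on W (fun q => dot l (q - p)).
  move=> oW; apply: smooth_dot => // k; first exact: Ck_on_cst.
  by apply: Ck_onD => //; [exact: Ck_on_id|exact: Ck_on_cst].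
have xp : x p = 0 by rewrite /x subrr dot0r.
have yp : y p = 0 by rewrite /y subrr dot0r.
have ap0 : a p != 0 by rewrite ap mulf_eq0 negb_or Geee invr_eq0 pnatr_eq0.
have cp0 : c p != 0 by rewrite cp mulf_eq0 negb_or Gww invr_eq0 pnatr_eq0.
(* Roots need positive bases: multiplication by the sign at [p] makes both coefficients positive
   there, and the domain is shrunk first to keep [c'] positive, which allows division by [c], then
   to keep [d'] positive. *)
pose s := (c p < 0)%R; pose t := (a p < 0)%R.
pose c' q := (-1) ^+ s * c q.
have sc' : smooth_on V c' by apply: smoothM => //; exact: smooth_cst.
pose V1 := [set q | V q /\ 0 < c' q].
have oV1 : open V1 by apply: open_pos => // q Vq; exact: smooth_cont sc' Vq.
have V1V : V1 `<=` V by move=> q [].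
have V1p : V1 p by split=> //; exact: sign_pos.
have c0 q : V1 q -> c q != 0.
  by move=> [_]; rewrite /c'; apply: contraTneq => ->; rewrite mulr0 ltxx.
pose r1 q := b q / (2 * c q); pose r2 q := b q ^+ 2 / (4 * c q).
have scV k : k != 0 -> smooth_on V1 (fun q => (k * c q)^-1).
  move=> k0; apply: smoothV => // [q /c0 cq|]; first by rewrite mulf_neq0.
  by apply: smoothM => //; [exact: smooth_cst|exact: smooth_onS V1V sc].
have sb1 := smooth_onS V1V sb.
have sr1 : smooth_on V1 r1 by apply: smoothM => //; apply: scV; rewrite pnatr_eq0.
have sr2 : smooth_on V1 r2.
  by apply: smoothM => //; [exact: smoothX|apply: scV; rewrite pnatr_eq0].
have sx1 : smooth_on V1 x by exact: sxy.
have sy1 : smooth_on V1 y by exact: sxy.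
pose d' q := (-1) ^+ t * (a q - x q * r2 q).
have sd' : smooth_on V1 d'.
  apply: smoothM => //; first exact: smooth_cst.
  by apply: smoothB => //; [exact: smooth_onS V1V sa|exact: smoothM].
pose V2 := [set q | V1 q /\ 0 < d' q].
have oV2 : open V2 by apply: open_pos => // q Vq; exact: smooth_cont sd' Vq.
have V21 : V2 `<=` V1 by move=> q [].
have V2p : V2 p by split=> //; rewrite /d' xp mul0r subr0; exact: sign_pos.
pose A q := d' q `^ 3^-1; pose B q := c' q `^ 2^-1.
have sA : smooth_on V2 A.
  by apply: smooth_powR => // [q []//|]; exact: smooth_onS V21 sd'.
have sB : smooth_on V2 B.
  apply: smooth_powR => // [q [[]]//|].
  by apply: smooth_onS sc' => q /V21/V1V.
pose m q := y q + x q * (x q * r1 q).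
have sx2 := smooth_onS V21 sx1; have sy2 := smooth_onS V21 sy1.
have sxr : smooth_on V2 (fun q => x q * r1 q).
  by apply: smoothM => //; exact: smooth_onS V21 sr1.
have sm : smooth_on V2 m by apply: smoothD => //; exact: smoothM.
(* In each coordinate the first factor vanishes at [p], so the differential at [p] is [A p] times
   [lx] and [B p] times [ly], which is injective. *)
pose Phi q : 'rV[R]_2 := \row_j (if j == 0 then x q * A q else m q * B q).
have Phi0 q : Phi q 0 0 = x q * A q by rewrite mxE.
have Phi1 q : Phi q 0 1 = m q * B q by rewrite mxE.
have sPhi : smooth_on V2 Phi.
  apply/smooth_coordP => // j; have [->|j0] := eqVneq j 0.
    apply: (smooth_on_eq oV2 _ (smoothM oV2 sx2 sA)) => q _.
    by rewrite Phi0.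
  apply: (smooth_on_eq oV2 _ (smoothM oV2 sm sB)) => q _.
  by rewrite mxE (negPf j0).
have mp : m p = 0 by rewrite /m xp yp mul0r addr0.
have Dx v : 'D_v x p = dot lx v := @derive_val _ _ _ _ _ _ _ (is_derive_dot lx p p v).
have Dy v : 'D_v y p = dot ly v := @derive_val _ _ _ _ _ _ _ (is_derive_dot ly p p v).
have dx v : derivable x p v by exact: smooth_derivable sx2 V2p.
have dy v : derivable y p v by exact: smooth_derivable sy2 V2p.
have D0 v : 'D_v (fun q => x q * A q) p = dot lx v * A p.
  rewrite -Dx; apply: (@derive_val _ _ _ _ _ _ _ _).
  by apply: is_derive_mul0 => //; exact: smooth_cont sA V2p.
have Dxx v : 'D_v (fun q => x q * (x q * r1 q)) p = 0.
  rewrite (@derive_val _ _ _ _ _ _ _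
    (is_derive_mul0 xp (dx v) (smooth_cont sxr V2p))).
  by rewrite xp mul0r mulr0.
have Dm v : 'D_v m p = dot ly v.
  rewrite [LHS]derive_addf//; last first.
    by apply: smooth_derivable V2p; exact: smoothM.
  by rewrite Dxx Dy addr0.
have D1 v : 'D_v (fun q => m q * B q) p = dot ly v * B p.
  rewrite -Dm; apply: (@derive_val _ _ _ _ _ _ _ _).
  apply: is_derive_mul0 => //; last exact: smooth_cont sB V2p.
  exact: smooth_derivable sm V2p.
have injPhi v : 'D_v Phi p = 0 -> v = 0.
  move=> Dv.
  have E j : 'D_v (fun q => Phi q 0 j) p = 0.
    by rewrite -derive_coord ?Dv ?mxE//; exact: smooth_derivable sPhi V2p.
  have Ap : A p != 0 by rewrite gt_eqF// powR_gt0//; case: V2p.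
  have Bp : B p != 0 by rewrite gt_eqF// powR_gt0//; case: V1p.
  have := E 0; rewrite (_ : (fun q => Phi q 0 0) = fun q => x q * A q); last first.
    by apply/funext => q; rewrite Phi0.
  rewrite D0 => /eqP; rewrite mulf_eq0 (negPf Ap) orbF => /eqP lxv.
  have := E 1; rewrite (_ : (fun q => Phi q 0 1) = fun q => m q * B q); last first.
    by apply/funext => q; rewrite Phi1.
  rewrite D1 => /eqP; rewrite mulf_eq0 (negPf Bp) orbF => /eqP lyv.
  by rewrite (dec v) lxv lyv !scale0r addr0.
have [V' [W [psi [V'V V'p diffeo]]]] := inverse_function oV2 V2p sPhi injPhi.
have dG : differentiable G p by exact: smooth_diff sG Up.
split.
  split=> // X; rewrite -deriveE// (dec X) deriveDr//.
  by rewrite Ge scaler0 add0r deriveE// linearZ/= -deriveE// Gw scaler0.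
(* The order is exchanged: [Ak_point] takes the sign of the power [k.+1] first, here [t] from [a],
   then the sign [s] of the square, from [c]. *)
exists t, s, (G p), V', W, Phi, psi; split=> //.
  apply/rowP => j; rewrite !mxE xp mp !mul0r; by case: ifP.
move=> q /V'V V2q; have [V1q dq] := V2q; have [Vq cq] := V1q.
rewrite Phi0 Phi1 !exprMn cbrtK// sqrtK// {1}(EG q Vq) -/(x q) -/(y q).
rewrite mulrCA sign_mulK [_ ^+ 2 * c' q]mulrC [(-1) ^+ s * _]mulrA sign_mulK.
by rewrite -!addrA; congr (_ + _); rewrite addrA complete_square// c0.
Qed.

(** In the coordinates [u], [y] the derivative along [e] is [u * P + y * Q], with [u], [y] and [P]
    zero at [p]. The vanishing of all its derivatives forces [Q p = 0], that is ['D_e y p = 0]; as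
    the coordinate change has injective differential, ['D_e u p] is nonzero, and only the cube
    contributes to the third derivative. *)
Lemma Ak2_third_derive U G p e : open U -> U p -> smooth_on U G ->
  Ak_point 2 G p -> e != 0 ->
  (forall v, 'D_v (fun z => 'D_e G z) p = 0) ->
  'D_e (fun z => 'D_e (fun z => 'D_e G z) z) p != 0.
Proof.
move=> oU Up sG [_ [s [t [c [V [W [phi [psi [diffeo Vp phip EG]]]]]]]]] e0 Hess.
have [oV oW sphi spsi [phiK psiK]] := diffeo.
pose u q := phi q 0 0; pose y q := phi q 0 1.
have su : smooth_on V u by move/(smooth_coordP _ oV) : sphi; exact.
have sy : smooth_on V y by move/(smooth_coordP _ oV) : sphi; exact.
have up : u p = 0 by rewrite /u phip mxE.
have yp : y p = 0 by rewrite /y phip mxE.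
pose a q := 'D_e u q; pose b q := 'D_e y q.
have sa : smooth_on V a by exact: smooth_derive.
have sb : smooth_on V b by exact: smooth_derive.
pose P q := (-1) ^+ s * 3 * (u q * a q); pose Q q := (-1) ^+ t * 2 * b q.
have sP : smooth_on V P by apply: smoothM => //; [exact: smooth_cst|exact: smoothM].
have sQ : smooth_on V Q by apply: smoothM => //; exact: smooth_cst.
have sc1 (k : R) := @smooth_cst R V k.
have dV (f : 'rV[R]_2 -> R) q v : smooth_on V f -> V q -> derivable f q v.
  by move=> sf Vq; exact: smooth_derivable sf Vq.
have D1 q : V q -> 'D_e G q = u q * P q + y q * Q q.
  move=> Vq; rewrite (derive_eq_on e oV EG Vq) -/u -/y.
  have s3 : smooth_on V (fun q => (-1) ^+ s * u q ^+ 3).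
    by apply: smoothM => //; exact: smoothX.
  have s2 : smooth_on V (fun q => (-1) ^+ t * y q ^+ 2).
    by apply: smoothM => //; exact: smoothX.
  rewrite [LHS]derive_addf; [|by apply: dV Vq; exact: smoothD|exact: dV].
  rewrite [X in X + _]derive_addf; [|exact: dV|exact: dV].
  rewrite derive_cst add0r [X in X + _]derive_mulfl; last first.
    by apply: dV Vq; exact: smoothX.
  rewrite [X in _ + X]derive_mulfl; last by apply: dV Vq; exact: smoothX.
  rewrite !derive_expf; [|exact: dV|exact: dV].
  have alg (m n x1 x2 y1 y2 : R) : m * (3 * x1 ^+ 2 * x2) + n * (2 * y1 ^+ 1 * y2) =
    x1 * (m * 3 * (x1 * x2)) + y1 * (n * 2 * y2) by ring.
  exact: alg.
have Pp : P p = 0 by rewrite /P up mul0r mulr0.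
have sumD (f1 f2 g1 g2 : 'rV[R]_2 -> R) q v : smooth_on V f1 -> smooth_on V f2 ->
    smooth_on V g1 -> smooth_on V g2 -> V q ->
    'D_v (fun z => f1 z * g1 z + f2 z * g2 z) q =
    'D_v f1 q * g1 q + f1 q * 'D_v g1 q + ('D_v f2 q * g2 q + f2 q * 'D_v g2 q).
  move=> sf1 sf2 sg1 sg2 Vq.
  rewrite derive_addf; [|by apply: dV Vq; exact: smoothM|by apply: dV Vq; exact: smoothM].
  by rewrite !derive_mulf//; exact: dV.
have D2 v q : V q -> 'D_v (fun z => 'D_e G z) q =
    'D_v u q * P q + u q * 'D_v P q + ('D_v y q * Q q + y q * 'D_v Q q).
  by move=> Vq; rewrite (derive_eq_on v oV D1 Vq); exact: sumD.
have inj v : 'D_v phi p = 0 -> v = 0.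
  move=> Dv; have [Wp psip] := phiK p Vp.
  have := derive_comp v (smooth_diff sphi Vp) (smooth_diff spsi Wp).
  rewrite Dv derive0 => D0; rewrite -D0 -[LHS](derive_id p v).
  by apply: (derive_eq_on v oV _ Vp) => z /phiK[].
(* The witness is the image of the second basis vector under the differential of the inverse chart;
   [y] has derivative one along it. *)
have [v yv] : exists v, 'D_v y p != 0.
  have Wp : W 0 by rewrite -phip; case: (phiK p Vp).
  have [V0 E0] := psiK 0 Wp.
  have psi0 : psi 0 = p by rewrite -phip; case: (phiK p Vp).
  have Vp0 : V (psi 0) by rewrite psi0.
  exists ('D_(delta_mx 0 1) psi 0).
  have := derive_comp (delta_mx 0 1) (smooth_diff spsi Wp) (smooth_diff sphi Vp0).
  rewrite psi0 => E; rewrite -derive_coord; last exact: smooth_derivable sphi Vp.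
  rewrite -E (derive_eq_on (g' := id) _ oW _ Wp); last by move=> z /psiK[].
  by rewrite derive_id mxE !eqxx/= oner_eq0.
have Qp : Q p = 0.
  have := Hess v; rewrite (D2 _ _ Vp) up yp Pp mulr0 !mul0r !addr0 add0r => /eqP.
  by rewrite mulf_eq0 (negPf yv)/= => /eqP.
have bp : b p = 0.
  move: Qp => /eqP; rewrite /Q !mulf_eq0 signr_eq0 pnatr_eq0/=.
  by move/eqP.
have ap : a p != 0.
  apply: contra_neq e0 => ap; apply: inj; apply/rowP => j.
  rewrite derive_coord ?mxE; last exact: smooth_derivable sphi Vp.
  by have [->|->] : j = 0 \/ j = 1 by
    case: (unliftP 0 j) => [j'|] ->; [right; rewrite (ord1 j')|left]; exact: val_inj.
have sDP := smooth_derive e sP; have sDQ := smooth_derive e sQ.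
have DP : 'D_e P p = (-1) ^+ s * 3 * a p ^+ 2.
  rewrite derive_mulfl; last by apply: dV Vp; exact: smoothM.
  by rewrite derive_mulf ?up ?mul0r ?addr0 -?expr2//; exact: dV.
rewrite (derive_eq_on e oV (D2 e) Vp).
rewrite derive_addf; last first.
- by apply: dV Vp; apply: smoothD => //; exact: smoothM.
- by apply: dV Vp; apply: smoothD => //; exact: smoothM.
rewrite (sumD a u P _ p e sa su sP sDP Vp) (sumD b y Q _ p e sb sy sQ sDQ Vp).
rewrite up yp Pp Qp (_ : 'D_e u p = a p)// (_ : 'D_e y p = b p)// bp DP.
have alg (x m d1 d2 d3 d4 d5 d6 : R) :
  d1 * 0 + x * (m * 3 * x ^+ 2) + (x * (m * 3 * x ^+ 2) + 0 * d2)
  + (d3 * 0 + 0 * d4 + (0 * d5 + 0 * d6)) = m * (6 * x ^+ 3) by ring.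
rewrite alg; apply: mulf_neq0; first by rewrite signr_eq0.
by apply: mulf_neq0; [rewrite pnatr_eq0|exact: expf_neq0].
Qed.

End cubic_fold.

(** * Support function and focal map *)

(** In the product rule at [p] every term except ['D_v a p * b p] contains a factor that vanishes
    there. *)
Lemma derive_det0 (R : realType) (V : normedModType R) (a b c d : V -> R)
    (p v : V) :
  derivable a p v -> derivable b p v -> derivable c p v -> derivable d p v ->
  (\forall q \near p, a q * b q = c q * d q) ->
  a p = 0 -> c p = 0 -> d p = 0 -> b p != 0 -> 'D_v a p = 0.
Proof.
move=> da db dc dd E a0 c0 d0 b0; have := near_eq_derive v E.
rewrite derive_mulf// derive_mulf// a0 c0 d0 !mulr0 !mul0r !addr0 => /eqP.
by rewrite mulf_eq0 (negPf b0) orbF => /eqP.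
Qed.

Section support_function.
Local Opaque derive.
Context {R : realType}.
Variables (U : set 'rV[R]_2) (f xi nu : 'rV[R]_2 -> 'rV[R]_3).
Variables (S : 'rV[R]_2 -> 'M[R]_2) (tau : 'rV[R]_2 -> 'rV[R]_2 -> R).
Variable nabla : ('rV[R]_2 -> 'rV[R]_2) -> ('rV[R]_2 -> 'rV[R]_2) ->
  'rV[R]_2 -> 'rV[R]_2.
Variable h : 'rV[R]_2 -> 'rV[R]_2 -> 'rV[R]_2 -> R.
Hypotheses (lc : line_congruence U f xi) (wein : weingarten_eq U f xi S tau).
Hypotheses (gauss : gauss_eq U f xi nabla h) (eqa : equiaffine U tau h).
Hypothesis conu : conormal U f xi nu.
Implicit Types (p q X Y e w : 'rV[R]_2) (a b : R).

Lemma schwarz_vec n (g : 'rV[R]_2 -> 'rV[R]_n) V q X Y : open V -> V q ->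
  smooth_on V g ->
  'D_X (fun z => 'D_Y g z) q = 'D_Y (fun z => 'D_X g z) q.
Proof.
move=> oV Vq sg; apply/rowP => j.
have sgj : smooth_on V (fun z => g z 0 j) by move/(smooth_coordP _ oV) : sg; exact.
have E X' Y' : ('D_X' (fun z => 'D_Y' g z) q) 0 j =
    'D_X' (fun z => 'D_Y' (fun z => g z 0 j) z) q.
  rewrite derive_coord; last exact: smooth_derivable (smooth_derive Y' sg) Vq.
  apply: (derive_eq_on X' oV _ Vq) => z Vz.
  by rewrite derive_coord//; exact: smooth_derivable sg Vz.
have Sj := schwarz X Y oV Vq (sgj 2%N).
exact: etrans (E X Y) (etrans Sj (esym (E Y X))).
Qed.

Let opp_eq (x y z : R) : x = - y -> x = - z -> y = z.
Proof. by move=> -> /oppr_inj. Qed.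

Let opp_comb (x y z b : R) : b * - y - z = - x -> x = b * y + z.
Proof. by lra. Qed.

Let third_alg (b c k A B C : R) : b * c = 1 -> - k = A - c * B ->
  b * A - B + C = C - b * k.
Proof.
move=> bc E; have -> : A = - k + c * B by rewrite E subrK.
by rewrite mulrDr mulrA bc mul1r mulrN addrK addrC.
Qed.

Let frac_neq0 (x y z : R) : x != 0 -> y != 0 -> z != 0 -> - (x * y / z) != 0.
Proof. by move=> x0 y0 z0; rewrite oppr_eq0 !mulf_neq0// invr_eq0. Qed.

Let oU : open U. Proof. by case: lc. Qed.
Let sf : smooth_on U f. Proof. by case: lc. Qed.
Let sxi : smooth_on U xi. Proof. by case: lc. Qed.

(** A nonzero [a] would place [xi q] in the tangent plane, against transversality; the rest is
    injectivity of the differential of [f]. *)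
Lemma frame_free q X a : U q -> 'D_X f q + a *: xi q = 0 -> X = 0 /\ a = 0.
Proof.
move=> Uq E; have [_ _ _ imm tr] := lc; have [df inj] := imm q Uq.
have a0 : a = 0.
  apply/eqP; apply: contrapT => /negP a0; apply: (tr q Uq).
  exists (- a^-1 *: X) => //; rewrite linearZ/= -deriveE//.
  move/eqP : E; rewrite addr_eq0 => /eqP ->.
  by rewrite scaleNr scalerN opprK scalerA mulVf// scale1r.
split=> //; apply: inj; rewrite linear0 -deriveE//.
by rewrite -E a0 scale0r addr0.
Qed.

(** The conditions on [nu] form a linear system whose matrix [N] has the two partial derivatives of
    [f] and [xi] as rows, with right-hand side [(0, 0, 1)]. [N] is invertible by [frame_free], so
    [nu] is given by Cramer's rule. *)
Lemma smooth_conormal : smooth_on U nu.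
Proof.
pose N q : 'M[R]_3 := \matrix_(i, j)
  (if i == 0 then 'D_(delta_mx 0 0) f q 0 j else
   if i == 1 then 'D_(delta_mx 0 1) f q 0 j else xi q 0 j).
have N0 q : row 0 (N q) = 'D_(delta_mx 0 0) f q by apply/rowP => j; rewrite !mxE.
have N1 q : row 1 (N q) = 'D_(delta_mx 0 1) f q by apply/rowP => j; rewrite !mxE.
have N2 q : row ord_max (N q) = xi q by apply/rowP => j; rewrite !mxE.
have uN q : U q -> N q \in unitmx.
  move=> Uq; apply: unitmx_inj => v.
  rewrite mulmx_sum_row !big_ord_recl big_ord0 addr0.
  rewrite (_ : lift ord0 ord0 = 1); last exact: val_inj.
  rewrite (_ : lift ord0 _ = ord_max); last exact: val_inj.
  rewrite N0 N1 N2 addrA => E.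
  have df := smooth_diff sf Uq.
  pose X : 'rV[R]_2 := v 0 0 *: delta_mx 0 0 + v 0 1 *: delta_mx 0 1.
  have : 'D_X f q + v 0 ord_max *: xi q = 0.
    by rewrite -E /X (deriveDr _ _ _ df) (deriveZr _ _ df).
  move=> /(frame_free Uq)[X0 v2].
  have v0 : v 0 0 = 0.
    by have := congr1 (fun X : 'rV[R]_2 => X 0 0) X0; rewrite !mxE/= mulr1 mulr0 addr0.
  have v1 : v 0 1 = 0.
    by have := congr1 (fun X : 'rV[R]_2 => X 0 1) X0; rewrite !mxE/= mulr1 mulr0 add0r.
  apply/rowP => j; rewrite mxE; case: (unliftP 0 j) => [j'|] ->; last exact: v0.
  case: (unliftP 0 j') => [j''|] ->; last by rewrite -[RHS]v1; congr (v _ _); exact: val_inj.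
  by rewrite -[RHS]v2; congr (v _ _); apply: val_inj; rewrite /= (ord1 j'').
have nuE q : U q -> nu q = delta_mx 0 ord_max *m invmx (N q)^T.
  move=> Uq; have uNT : (N q)^T \in unitmx by rewrite unitmx_tr uN.
  apply: (can_inj (mulmxK uNT)); rewrite mulmxKV//.
  have [nf nx] := conu Uq.
  have E i : (nu q *m (N q)^T) 0 i = dot (nu q) (row i (N q)).
    by rewrite mxE; apply: eq_bigr => k _; rewrite !mxE.
  apply/rowP => j; rewrite E mxE eqxx/=.
  case: (unliftP 0 j) => [j'|] ->; last by rewrite N0 nf.
  case: (unliftP 0 j') => [j''|] ->.
    rewrite (_ : lift _ _ = ord_max); last by apply: val_inj; rewrite /= (ord1 j'').
    by rewrite N2 nx eqxx.
  rewrite (_ : lift _ _ = 1); last exact: val_inj.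
  by rewrite N1 nf.
move=> k; apply/(Ck_on_coordP _ _ oU) => j.
apply: (Ck_on_eq oU (g := fun q => (delta_mx 0 ord_max *m invmx (N q)^T : 'rV[R]_3) 0 j)).
  by move=> q Uq; rewrite nuE.
apply: Ck_on_mulmx => // [i l|i l]; first exact: Ck_on_cst.
apply: Ck_on_invmx => // [q Uq|i' l']; first by rewrite unitmx_tr uN.
have sNl m : Ck_on k U (fun q => ('D_(delta_mx 0 m) f q) 0 i').
  by have /(Ck_on_coordP _ _ oU) := smooth_derive (delta_mx 0 m) sf k; exact.
have sxl : Ck_on k U (fun q => xi q 0 i').
  by have /(Ck_on_coordP _ _ oU) := sxi k; exact.
apply: (Ck_on_eq oU (g := fun q => if l' == 0 then ('D_(delta_mx 0 0) f q) 0 i' else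
   if l' == 1 then ('D_(delta_mx 0 1) f q) 0 i' else xi q 0 i')).
  by move=> q _; rewrite !mxE.
case: (l' == 0); first exact: sNl.
by case: (l' == 1); [exact: sNl|exact: sxl].
Qed.

Let snu := smooth_conormal.

Definition aff_form X Y q := dot (nu q) ('D_X (fun z => 'D_Y f z) q).
Definition dual_form X Y q := dot ('D_X nu q) ('D_Y xi q).
Local Notation H := aff_form.
Local Notation K := dual_form.

Lemma nu_tangent q X : U q -> dot (nu q) ('D_X f q) = 0.
Proof.
move=> Uq; have [nf _] := conu Uq; have df := smooth_diff sf Uq.
have := derive_basis X df; rewrite big_ord_recl big_ord1 => ->.
rewrite (_ : lift _ _ = 1); last exact: val_inj.
have [n0 n1] := (nf 0, nf 1); move: ('D__ f q) ('D__ f q) n0 n1 => A B nA nB.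
by rewrite dotDr !dotZr nA nB !mulr0 addr0.
Qed.

(** The Gauss equation for constant vector fields, paired with [nu], which kills the tangential
    part. *)
Lemma aff_formE q X Y : U q -> H X Y q = h q X Y.
Proof.
move=> Uq; have sc Z : smooth_on U (fun _ : 'rV[R]_2 => Z : 'rV[R]_2).
  by move=> k; exact: Ck_on_cst.
have := gauss (sc X) (sc Y) Uq => /= E.
have [_ nx] := conu Uq.
rewrite /H (derive_eq_on (g' := fun z => 'd f z Y) X oU _ Uq); last first.
  by move=> z Uz; rewrite deriveE//; exact: smooth_diff sf Uz.
rewrite E dotDr dotZr nx mulr1 -deriveE ?nu_tangent ?add0r//.
exact: smooth_diff sf Uq.
Qed.

(** Differentiating [nu_tangent]. Linearity of [H] in its second argument is read off this
    formula. *)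
Lemma derive_nu_tangent q X Y : U q -> dot ('D_X nu q) ('D_Y f q) = - H X Y q.
Proof.
move=> Uq; apply/eqP; rewrite -addr_eq0 -derive_dot.
- apply/eqP; rewrite (derive_eq_on (g' := fun _ => 0) X oU _ Uq) ?derive_cst//.
  by move=> z Uz; exact: nu_tangent.
- exact: smooth_derivable snu Uq.
- exact: smooth_derivable (smooth_derive Y sf) Uq.
Qed.

Lemma derive_xi q X : U q -> 'D_X xi q = - 'D_(X *m S q) f q.
Proof.
move=> Uq; have [t0 _] := eqa.
rewrite (wein X Uq) (t0 _ _ Uq) scale0r addr0 deriveE//.
exact: smooth_diff sf Uq.
Qed.

(** Since [tau] vanishes, [xi] has tangential derivatives, which [nu] annihilates; the derivative of
    [dot nu xi = 1] leaves this. It is why every point of the line through [f q] directed by [xi q]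
    has [q] as a critical point of its support function. *)
Lemma derive_nu_xi q X : U q -> dot ('D_X nu q) (xi q) = 0.
Proof.
move=> Uq; have E : dot ('D_X nu q) (xi q) + dot (nu q) ('D_X xi q) = 0.
  rewrite -derive_dot; [|exact: smooth_derivable snu Uq|exact: smooth_derivable sxi Uq].
  rewrite (derive_eq_on (g' := fun _ => 1 : R) X oU _ Uq) ?derive_cst//.
  by move=> z Uz; have [] := conu Uz.
by rewrite -E derive_xi// dotNr nu_tangent// oppr0 addr0.
Qed.

Lemma dual_formE q X Y : U q -> K X Y q = H X (Y *m S q) q.
Proof.
by move=> Uq; rewrite /K derive_xi// dotNr derive_nu_tangent// opprK.
Qed.

Lemma derive2_nu_xi q X Y : U q ->
  dot ('D_Y (fun z => 'D_X nu z) q) (xi q) = - K X Y q.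
Proof.
move=> Uq; apply/eqP; rewrite -addr_eq0 -derive_dot.
- apply/eqP; rewrite (derive_eq_on (g' := fun _ => 0) Y oU _ Uq) ?derive_cst//.
  by move=> z Uz; exact: derive_nu_xi.
- exact: smooth_derivable (smooth_derive X snu) Uq.
- exact: smooth_derivable sxi Uq.
Qed.

Lemma aff_formC q X Y : U q -> H X Y q = H Y X q.
Proof. by move=> Uq; rewrite /H (schwarz_vec X Y oU Uq sf). Qed.

(** Both sides are minus the pairing of a mixed second derivative of [nu] with [xi], and mixed
    derivatives commute. *)
Lemma dual_formC q X Y : U q -> K X Y q = K Y X q.
Proof.
move=> Uq; have E1 := derive2_nu_xi X Y Uq; have E2 := derive2_nu_xi Y X Uq.
rewrite (schwarz_vec Y X oU Uq snu) in E1.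
exact: opp_eq E1 E2.
Qed.

Lemma aff_formDr q X Y Z a : U q -> H X (a *: Y + Z) q = a * H X Y q + H X Z q.
Proof.
move=> Uq; have E Z' := derive_nu_tangent X Z' Uq.
have EZ := E (a *: Y + Z).
rewrite (deriveDr _ _ _ (smooth_diff sf Uq)) dotDr dotZr (E Y) (E Z) in EZ.
exact: opp_comb EZ.
Qed.

Lemma aff_formZr q X Y a : U q -> H X (a *: Y) q = a * H X Y q.
Proof.
move=> Uq; have := derive_nu_tangent X 0 Uq.
rewrite derive0 dot0r => /esym/eqP; rewrite oppr_eq0 => /eqP H0.
by have := aff_formDr X Y 0 a Uq; rewrite H0 !addr0.
Qed.

Lemma aff_form_nondeg q X : U q -> (forall Y, H X Y q = 0) -> X = 0.
Proof.
move=> Uq H0; have [_ nd] := eqa; apply: (nd q) => // Y.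
by rewrite -aff_formE.
Qed.

Lemma smooth_aff_form X Y : smooth_on U (H X Y).
Proof. by apply: smooth_dot => //; do 2!apply: smooth_derive. Qed.

Lemma smooth_dual_form X Y : smooth_on U (K X Y).
Proof. by apply: smooth_dot => //; exact: smooth_derive. Qed.

(** [K X Y = H X (Y *m S)] reads, in matrices, as [Km] equal to [Hm] times the transpose of [S], and
    [Hm] is invertible because [h] is non-degenerate. *)
Lemma smooth_shape i j : smooth_on U (fun q => S q i j).
Proof.
pose Hm q : 'M[R]_2 := \matrix_(i, j) H (delta_mx 0 i) (delta_mx 0 j) q.
pose Km q : 'M[R]_2 := \matrix_(i, j) K (delta_mx 0 i) (delta_mx 0 j) q.
have HmE q X k : U q -> (X *m Hm q) 0 k = H X (delta_mx 0 k) q.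
  move=> Uq; rewrite aff_formC// [in RHS](rv2_decomp X) aff_formDr// aff_formZr//.
  rewrite mxE big_ord_recl big_ord1 (_ : lift _ _ = 1); last exact: val_inj.
  by rewrite ![Hm q _ _]mxE ![H (delta_mx 0 k) _ q]aff_formC.
have uHm q : U q -> Hm q \in unitmx.
  move=> Uq; apply: unitmx_inj => X X0; apply: (aff_form_nondeg Uq) => Y.
  rewrite (rv2_decomp Y) aff_formDr// aff_formZr// -!HmE// X0 !mxE.
  by rewrite !mulr0 addr0.
have KmE q : U q -> (S q)^T = invmx (Hm q) *m Km q.
  move=> Uq; apply: (can_inj (mulKmx (uHm q Uq))); rewrite mulKVmx ?uHm//.
  apply/matrixP => k l; rewrite [RHS]mxE dual_formE// -rowE.
  rewrite (rv2_decomp (row l (S q))) aff_formDr// aff_formZr//.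
  rewrite mxE big_ord_recl big_ord1 (_ : lift _ _ = 1); last exact: val_inj.
  rewrite ![Hm q _ _]mxE ![(S q)^T _ _]mxE ![row l _ _ _]mxE.
  by congr (_ + _); exact: mulrC.
move=> k; apply: (Ck_on_eq oU (g := fun q => (invmx (Hm q) *m Km q) j i)).
  by move=> q Uq; rewrite -KmE// mxE.
apply: Ck_on_mulmx => // i' j'.
  apply: Ck_on_invmx => // l m.
  by apply: (Ck_on_eq oU _ (smooth_aff_form _ _ k)) => q _; rewrite mxE.
by apply: (Ck_on_eq oU _ (smooth_dual_form _ _ k)) => q _; rewrite mxE.
Qed.

(** Guarantees that [lam i] is an eigenvalue on a neighbourhood of [p], so that the eigenvalue
    condition can be differentiated. *)
Lemma open_delta : open [set q | U q /\ 0 < delta (S q)].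
Proof.
apply: open_pos => // q Uq; have sS := smooth_shape.
have sd : smooth_on U (fun q => delta (S q)).
  rewrite /delta; apply: smoothD => //; first by apply: smoothX => //; exact: smoothB.
  by apply: smoothM => //; apply: smoothM => //; exact: smooth_cst.
exact: smooth_cont sd Uq.
Qed.

Lemma dual_formDr q X Y Z a : U q -> K X (a *: Y + Z) q = a * K X Y q + K X Z q.
Proof.
move=> Uq; rewrite (dual_formE X (a *: Y + Z) Uq) (dual_formE X Y Uq).
by rewrite (dual_formE X Z Uq) mulmxDl -scalemxAl aff_formDr.
Qed.

Local Notation rho Z := (fun q => support_fun f nu q Z).

Let smooth_Zf Z : smooth_on U (fun q => Z - f q).
Proof.
move=> k; apply: (Ck_on_eq oU (g := fun q => Z + (- 1) *: f q)).
  by move=> q _; rewrite scaleN1r.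
by apply: Ck_onD => //; [exact: Ck_on_cst|apply: Ck_onZ].
Qed.

Let derive_Zf Z q X : U q -> 'D_X (fun z => Z - f z) q = - 'D_X f q.
Proof.
move=> Uq; have := deriveB (@derivable_cst _ _ _ Z q X) (@smooth_derivable _ _ _ _ _ X sf Uq).
by rewrite derive_cst sub0r.
Qed.

Lemma smooth_support Z : smooth_on U (rho Z).
Proof. exact: smooth_dot. Qed.

Lemma derive_support Z q X : U q -> 'D_X (rho Z) q = dot ('D_X nu q) (Z - f q).
Proof.
move=> Uq; rewrite (derive_dot (@smooth_derivable _ _ _ _ _ X snu Uq)
  (@smooth_derivable _ _ _ _ _ X (smooth_Zf Z) Uq)).
by rewrite derive_Zf// dotNr nu_tangent// oppr0 addr0.
Qed.

Lemma derive2_support Z q X Y : U q -> 'D_Y (fun z => 'D_X (rho Z) z) q =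
  dot ('D_Y (fun z => 'D_X nu z) q) (Z - f q) + H X Y q.
Proof.
move=> Uq; rewrite (derive_eq_on Y oU (fun z => @derive_support Z z X) Uq).
rewrite (derive_dot (@smooth_derivable _ _ _ _ _ Y (smooth_derive X snu) Uq)
  (@smooth_derivable _ _ _ _ _ Y (smooth_Zf Z) Uq)).
by rewrite derive_Zf// dotNr derive_nu_tangent// opprK.
Qed.

Lemma derive3_support Z q X Y W : U q ->
  'D_W (fun z => 'D_Y (fun z => 'D_X (rho Z) z) z) q =
  dot ('D_W (fun z => 'D_Y (fun z => 'D_X nu z) z) q) (Z - f q)
  - dot ('D_Y (fun z => 'D_X nu z) q) ('D_W f q) + 'D_W (H X Y) q.
Proof.
move=> Uq; have s2 := smooth_derive Y (smooth_derive X snu).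
have sD := smooth_dot oU s2 (smooth_Zf Z).
have E1 := derive_eq_on W oU (fun z => @derive2_support Z z X Y) Uq.
have E2 := derive_addf (@smooth_derivable _ _ _ _ _ W sD Uq)
  (@smooth_derivable _ _ _ _ _ W (smooth_aff_form X Y) Uq).
have E3 := derive_dot (@smooth_derivable _ _ _ _ _ W s2 Uq)
  (@smooth_derivable _ _ _ _ _ W (smooth_Zf Z) Uq).
have E4 A := etrans (congr1 (dot A) (derive_Zf Z W Uq)) (dotNr A ('D_W f q)).
exact: etrans E1 (etrans E2 (congr1 (fun t => t + _)
  (etrans E3 (congr1 (fun t => _ + t) (E4 _))))).
Qed.

(** * Derivatives of the support function at a point of the line through [f p] *)

Section focal_point.
Variables (p : 'rV[R]_2) (a : R).
Hypothesis (Up : U p).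
Let Z := f p + a *: xi p.

Let ZfE : Z - f p = a *: xi p.
Proof. by rewrite /Z addrAC subrr add0r. Qed.

Lemma derive_support_focal X : 'D_X (rho Z) p = 0.
Proof. by rewrite derive_support// ZfE dotZr derive_nu_xi// mulr0. Qed.

Lemma derive2_support_focal X Y :
  'D_Y (fun z => 'D_X (rho Z) z) p = H X Y p - a * K X Y p.
Proof.
by rewrite derive2_support// ZfE dotZr derive2_nu_xi// mulrN addrC.
Qed.

(** The third derivatives of [nu] are eliminated by differentiating along [e] the relation between
    its second derivatives, [xi] and [K e e]. As ['D_e xi p] is [- a^-1] times ['D_e f p], the same
    relation, multiplied by [a], also absorbs the pairing of the second derivative of [nu] with
    ['D_e f p]. *)
Lemma derive3_support_focal e : a * a^-1 = 1 -> e *m S p = a^-1 *: e ->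
  'D_e (fun z => 'D_e (fun z => 'D_e (rho Z) z) z) p =
  'D_e (H e e) p - a * 'D_e (K e e) p.
Proof.
move=> aV eS; have s2 := smooth_derive e (smooth_derive e snu).
have E1 := @derive3_support Z p e e e Up.
have E2 A := etrans (congr1 (dot A) ZfE) (dotZr a A (xi p)).
have E3 := derive_dot (@smooth_derivable _ _ _ _ _ e s2 Up)
  (@smooth_derivable _ _ _ _ _ e sxi Up).
have E4 := derive_eq_on e oU (fun z => @derive2_nu_xi z e e) Up.
have E5 : 'D_e (fun z => - K e e z) p = - 'D_e (K e e) p.
  exact: deriveN (@smooth_derivable _ _ _ _ _ e (smooth_dual_form e e) Up).
have xiE : 'D_e xi p = - (a^-1 *: 'D_e f p).
  by rewrite (derive_xi e Up) eS (deriveZr _ _ (smooth_diff sf Up)).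
have E6 A := etrans (congr1 (dot A) xiE) (etrans (dotNr A (a^-1 *: 'D_e f p))
  (congr1 -%R (dotZr a^-1 A ('D_e f p)))).
have E7 := etrans (esym E5) (etrans (esym E4)
  (etrans E3 (congr1 (fun t => _ + t) (E6 _)))).
apply: etrans E1 (etrans (congr1 (fun t => t - dot ('D_e (fun z => 'D_e nu z) p)
  ('D_e f p) + 'D_e (H e e) p) (E2 _)) _).
exact: (third_alg _ aV E7).
Qed.

End focal_point.

(** The coordinates of the eigenvector [X] form a nonzero kernel vector of the matrix of [K - l H]
    in the basis [e], [w]. That basis stays fixed when [q] varies and [X] enters only through its
    existence, so the identity can be differentiated in [q]. *)
Lemma eigen_form_det l q e w X : U q -> e 0 0 * w 0 1 - e 0 1 * w 0 0 != 0 ->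
  X != 0 -> X *m S q = l *: X ->
  (K e e q - l * H e e q) * (K w w q - l * H w w q) =
  (K e w q - l * H e w q) * (K w e q - l * H w e q).
Proof.
move=> Uq ew X0 XS; have [lx [ly [_ _ _ _ dec]]] := dual_basis ew.
have M0 Y : dot lx X * (K Y e q - l * H Y e q) + dot ly X * (K Y w q - l * H Y w q) = 0.
  have E1 : K Y X q = l * H Y X q by rewrite dual_formE// XS aff_formZr.
  have E2 := aff_formDr Y e (dot ly X *: w) (dot lx X) Uq.
  have E3 := dual_formDr Y e (dot ly X *: w) (dot lx X) Uq.
  rewrite -dec aff_formZr// in E2; rewrite -dec in E3.
  have E4 := dual_formDr Y w 0 (dot ly X) Uq.
  rewrite addr0 (dual_formE Y 0 Uq) mul0mx in E4.
  have H0 : H Y 0 q = 0 by have := aff_formZr Y 0 0 Uq; rewrite scale0r mul0r.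
  rewrite H0 addr0 in E4; rewrite E4 in E3.
  by rewrite !mulrBr addrACA -E3 -opprD !(mulrCA _ l) -mulrDr -E2 E1 subrr.
have alg (x y m1 m2 m3 m4 : R) : x * m1 + y * m2 = 0 -> x * m3 + y * m4 = 0 ->
    x * (m1 * m4 - m2 * m3) = 0 /\ y * (m1 * m4 - m2 * m3) = 0.
  move=> E1 E2; split.
    have -> : x * (m1 * m4 - m2 * m3) = (x * m1 + y * m2) * m4 - (x * m3 + y * m4) * m2.
      by ring.
    by rewrite E1 E2 !mul0r subrr.
  have -> : y * (m1 * m4 - m2 * m3) = (x * m3 + y * m4) * m1 - (x * m1 + y * m2) * m3.
    by ring.
  by rewrite E1 E2 !mul0r subrr.
have [F1 F2] := alg _ _ _ _ _ _ (M0 e) (M0 w).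
apply/eqP; rewrite -subr_eq0; apply: contraNT X0 => D0.
move/eqP : F1; rewrite mulf_eq0 (negPf D0) orbF => /eqP x0.
move/eqP : F2; rewrite mulf_eq0 (negPf D0) orbF => /eqP y0.
by rewrite (dec X) x0 y0 !scale0r addr0.
Qed.

(** * The eigenvectors [e] and [w] of [S p], for [l p] and for the other eigenvalue *)

Section principal_direction.
Variables (l : 'rV[R]_2 -> R) (p e w : 'rV[R]_2) (mu : R).
Hypotheses (Up : U p) (dl : differentiable l p) (l0 : l p != 0).
Hypothesis near_eigen :
  \forall q \near p, U q /\ exists2 X : 'rV[R]_2, X != 0 & X *m S q = l q *: X.
Hypotheses (e0 : e != 0) (w0 : w != 0).
Hypotheses (eS : e *m S p = l p *: e) (wS : w *m S p = mu *: w).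
Hypothesis mul : mu != l p.
Let Z := f p + (l p)^-1 *: xi p.

Lemma eigen_independent : e 0 0 * w 0 1 - e 0 1 * w 0 0 != 0.
Proof.
have indep (a b : R) : a *: e + b *: w = 0 -> a = 0 /\ b = 0.
  move=> E; have := congr1 (mulmxr (S p)) E.
  rewrite /= mul0mx mulmxDl -!scalemxAl eS wS => E1.
  have : b *: ((mu - l p) *: w) = 0.
    have := congr1 (fun X => l p *: X) E; rewrite scaler0 scalerDr => E2.
    rewrite scalerBl scalerBr -[RHS](subrr 0) -{1}E1 -E2 opprD addrACA.
    by rewrite !scalerA [l p * a]mulrC [l p * b]mulrC subrr add0r.
  move/eqP; rewrite scalerA scaler_eq0 (negPf w0) orbF mulf_eq0 subr_eq0.
  rewrite (negPf mul) orbF => /eqP b0; split=> //.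
  move/eqP : E; rewrite b0 scale0r addr0 scaler_eq0 (negPf e0) orbF.
  by move/eqP.
apply: contra e0 => /eqP D0.
have vec (c d : R) : c * e 0 0 + d * w 0 0 = 0 -> c * e 0 1 + d * w 0 1 = 0 ->
    c = 0 /\ d = 0.
  move=> h0 h1; apply: indep; apply/rowP => j; rewrite !mxE.
  case: (unliftP 0 j) => [j'|] -> //; rewrite (ord1 j').
  by rewrite (_ : lift _ _ = 1)//; exact: val_inj.
(* When the determinant vanishes, so do the combinations of [e] and [w] with coefficients [w 0 j]
   and [- e 0 j]. *)
have [_ e00] : w 0 0 = 0 /\ - e 0 0 = 0.
  by apply: vec; [ring|rewrite -[RHS]oppr0 -D0; ring].
have [_ e01] : w 0 1 = 0 /\ - e 0 1 = 0.
  by apply: vec; [rewrite -[RHS]D0; ring|ring].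
apply/eqP; rewrite (rv2_decomp e).
by rewrite -[e 0 0]opprK -[e 0 1]opprK e00 e01 oppr0 !scale0r addr0.
Qed.

Let Kv X : K X e p = l p * H X e p.
Proof. by rewrite (dual_formE X e Up) eS (aff_formZr X e (l p) Up). Qed.

Let Kw X : K X w p = mu * H X w p.
Proof. by rewrite (dual_formE X w Up) wS (aff_formZr X w mu Up). Qed.

(** By symmetry of [H] and [K] the shape operator is self-adjoint for [H], so eigenvectors for
    distinct eigenvalues are orthogonal. *)
Let Hew : H e w p = 0.
Proof.
have E1 := Kw e; have E2 := Kv w.
rewrite (dual_formC w e Up) (aff_formC w e Up) E1 in E2.
move/eqP : E2; rewrite -subr_eq0 -mulrBl mulf_eq0 subr_eq0 (negPf mul).
by move/eqP.
Qed.

Let Hcomb X : exists a b, forall Y, H Y X p = a * H Y e p + b * H Y w p.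
Proof.
have [lx [ly [_ _ _ _ dec]]] := dual_basis eigen_independent.
exists (dot lx X), (dot ly X) => Y; rewrite {1}(dec X).
by rewrite (aff_formDr Y e (dot ly X *: w) (dot lx X) Up) (aff_formZr Y w _ Up).
Qed.

(** [e] and [w] are an orthogonal basis for [H]; if one of them were isotropic it would lie in the
    radical. *)
Lemma aff_form_principal : H e e p != 0 /\ H w w p != 0.
Proof.
split; [apply: contraNneq e0 => E|apply: contraNneq w0 => E];
  apply/eqP; apply: (aff_form_nondeg Up) => Y; have [a [b ->]] := Hcomb Y.
  by rewrite E Hew !mulr0 addr0.
by rewrite (aff_formC w e Up) E Hew !mulr0 addr0.
Qed.

(* The determinant of [K - l H] in the basis [e, w] vanishes identically and
   its other factors at [p] are [0] off the [w, w] entry. *)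
Lemma derive_dual_form :
  'D_e (K e e) p = 'D_e l p * H e e p + l p * 'D_e (H e e) p.
Proof.
pose m X Y q := K X Y q - l q * H X Y q.
have dH X Y : derivable (H X Y) p e.
  exact: smooth_derivable (smooth_aff_form X Y) Up.
have dK X Y : derivable (K X Y) p e.
  exact: smooth_derivable (smooth_dual_form X Y) Up.
have dl' : derivable l p e by exact: diff_derivable.
have dlH X Y := derivable_mulf dl' (dH X Y).
have dm X Y : derivable (m X Y) p e := derivable_subf (dK X Y) (dlH X Y).
have mE X : m X e p = 0 by rewrite /m Kv subrr.
have mew : m e w p = 0 by rewrite /m Kw Hew !mulr0 subrr.
have mww : m w w p != 0.
  by rewrite /m Kw -mulrBl mulf_neq0 ?subr_eq0//; case: aff_form_principal.
have E : \forall q \near p, m e e q * m w w q = m e w q * m w e q.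
  apply: filterS near_eigen => q [Uq [X X0 XS]].
  exact: eigen_form_det Uq eigen_independent X0 XS.
have D0 := derive_det0 (dm e e) (dm w w) (dm e w) (dm w e) E (mE e) mew (mE w) mww.
have D1 := derive_subf (dK e e) (dlH e e).
exact: etrans (subr0_eq (etrans (esym D1) D0)) (derive_mulf dl' (dH e e)).
Qed.

Lemma derive3_support_principal :
  'D_e (fun z => 'D_e (fun z => 'D_e (rho Z) z) z) p =
  - ('D_e l p * H e e p / l p).
Proof.
have aV : (l p)^-1 * (l p)^-1^-1 = 1 by rewrite mulfV// invr_eq0.
have eS' : e *m S p = (l p)^-1^-1 *: e by rewrite invrK.
apply: etrans (derive3_support_focal Up aV eS') _.
rewrite derive_dual_form; move: ('D_e l p) (H e e p) ('D_e (H e e) p) => x y z.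
by rewrite mulrDr [X in _ - (_ + X)]mulrA mulVf// mul1r opprD addrCA subrr addr0 mulrC.
Qed.

Lemma A2_support_principal : Ak_point 2 (rho Z) p <-> 'D_e l p != 0.
Proof.
have [Hee Hww] := aff_form_principal.
have D1 X : 'D_X (rho Z) p = 0 := derive_support_focal (l p)^-1 Up X.
have D2 X Y : 'D_Y (fun z => 'D_X (rho Z) z) p = H X Y p - (l p)^-1 * K X Y p.
  exact: derive2_support_focal.
have D2e X : 'D_e (fun z => 'D_X (rho Z) z) p = 0.
  by rewrite (D2 X e) Kv mulrA mulVf// mul1r subrr.
have D2e' X : 'D_X (fun z => 'D_e (rho Z) z) p = 0.
  rewrite (D2 e X) (dual_formC e X Up) (aff_formC e X Up) Kv mulrA mulVf//.
  by rewrite mul1r subrr.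
have sr := smooth_support Z.
have D3 := derive3_support_principal.
split=> [A2|dle].
  have := Ak2_third_derive oU Up sr A2 e0 D2e'.
  by rewrite D3; apply: contra_neq => ->; rewrite !mul0r oppr0.
apply: (derive_normal_form oU Up sr eigen_independent) => //.
  (* The Hessian along [w] is [(1 - mu / l p) * H w w p]. *)
  rewrite (D2 w w) Kw mulrA -{1}[H w w p]mul1r -mulrBl mulf_neq0//.
  by rewrite subr_eq0 eq_sym mulrC -(inj_eq (mulIf l0)) divfK// mul1r.
exact: (eq_ind_r (fun t => t != 0) (frac_neq0 dle Hee l0) D3).
Qed.

Let focal_derive X : differentiable (focal f xi l) p /\
  'D_X (focal f xi l) p =
  'D_(- (l p)^-1 *: (X *m S p) + X) f p + (- (l p) ^- 2 * 'D_X l p) *: xi p.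
Proof.
have df := smooth_diff sf Up; have dxi := smooth_diff sxi Up.
have dV : differentiable (fun z => (l z)^-1) p by exact: differentiableV.
have dfj j : differentiable (fun z => f z 0 j) p by move/differentiable_coordP : df; exact.
have dxj j : differentiable (fun z => xi z 0 j) p by move/differentiable_coordP : dxi; exact.
have dVx j : differentiable (fun z => (l z)^-1 * xi z 0 j) p.
  exact: (differentiableM dV (dxj j)).
have FE j : (fun z => focal f xi l z 0 j) = fun z => f z 0 j + (l z)^-1 * xi z 0 j.
  by apply/funext => z; rewrite !mxE.
have dF : differentiable (focal f xi l) p.
  apply/differentiable_coordP => j; rewrite FE.
  exact: (differentiableD (dfj j) (dVx j)).
split=> //; rewrite (deriveDr _ _ _ df).
have xiE := derive_xi X Up.
apply/rowP => j; rewrite (derive_coord _ (diff_derivable dF)) FE.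
have E1 := derive_addf (@diff_derivable _ _ _ _ _ X (dfj j)) (@diff_derivable _ _ _ _ _ X (dVx j)).
have E2 := derive_mulf (@diff_derivable _ _ _ _ _ X dV) (@diff_derivable _ _ _ _ _ X (dxj j)).
have E3 := derive_invf l0 (@diff_derivable _ _ _ _ _ X dl).
have E4 := derive_coord j (@diff_derivable _ _ _ _ _ X df).
have E5 := derive_coord j (@diff_derivable _ _ _ _ _ X dxi).
apply: etrans E1 _; rewrite E2 E3 -E4 -E5 xiE.
move: ('D_X f p) ('D__ f p) ('D_X l p) => A B c; rewrite !mxE; ring.
Qed.

(** The tangential part of the differential multiplies [w] by [1 - mu / l p], which is nonzero, and
    kills [e]; a kernel vector is therefore a multiple of [e], and the [xi] component decides
    whether it is zero. *)
Lemma immersion_focal_principal : immersion_at (focal f xi l) p <-> 'D_e l p != 0.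
Proof.
have dF := (focal_derive 0).1; split=> [[_ inj]|dle].
  apply: contra_neq e0 => dle; apply: inj; rewrite linear0 -deriveE//.
  rewrite (focal_derive e).2 dle mulr0 scale0r addr0 eS scalerA mulNr mulVf//.
  by rewrite scaleN1r addNr derive0.
split=> // X Y E; apply/eqP; rewrite -subr_eq0; apply/eqP; move: E => /eqP.
rewrite -subr_eq0 -linearB -deriveE//; move: (X - Y) => {X Y}X /eqP.
rewrite (focal_derive X).2 => /(frame_free Up)[EX /eqP].
rewrite mulf_eq0 oppr_eq0 invr_eq0 expf_eq0 (negPf l0) andbF/= => /eqP dX.
have [lx [ly [_ _ _ _ dec]]] := dual_basis eigen_independent.
have XE := dec X; move: (dot lx X) (dot ly X) XE => a b XE.
have b0 : b = 0.
  have : (b * (1 - mu / l p)) *: w = 0.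
    rewrite -EX XE mulmxDl -!scalemxAl eS wS; apply/rowP => j; rewrite !mxE.
    by field.
  move/eqP; rewrite scaler_eq0 (negPf w0) orbF mulf_eq0 => /orP[/eqP//|].
  by rewrite subr_eq0 -(inj_eq (mulIf l0)) divfK// mul1r eq_sym (negPf mul).
move: XE; rewrite b0 scale0r addr0 => XE.
move: dX; rewrite XE (deriveZr _ _ dl) => /eqP.
by rewrite scaler_eq0 (negPf dle) orbF => /eqP ->; rewrite scale0r.
Qed.

End principal_direction.

End support_function.

Unset Implicit Arguments.

Theorem corollary7p1 (R : realType) (U : set 'rV[R]_2)
    (f xi : 'rV[R]_2 -> 'rV[R]_3)
    (S : 'rV[R]_2 -> 'M[R]_2)
    (tau : 'rV[R]_2 -> 'rV[R]_2 -> R)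
    (nabla : ('rV[R]_2 -> 'rV[R]_2) -> ('rV[R]_2 -> 'rV[R]_2) ->
             'rV[R]_2 -> 'rV[R]_2)
    (h : 'rV[R]_2 -> 'rV[R]_2 -> 'rV[R]_2 -> R)
    (nu : 'rV[R]_2 -> 'rV[R]_3)
    (lam : 'I_2 -> 'rV[R]_2 -> R)
    (i : 'I_2) (p : 'rV[R]_2) :
  line_congruence U f xi ->
  weingarten_eq U f xi S tau ->
  gauss_eq U f xi nabla h ->
  equiaffine U tau h ->
  conormal U f xi nu ->
  principal_curvatures U S lam ->
  U p -> 0 < delta (S p) -> lam i p != 0 ->
  let Zi := f p + (lam i p)^-1 *: xi p in
  Ak_point 2 (fun q => support_fun f nu q Zi) p <->
  ~ ridge_point U f xi S lam i p.
Proof.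
move=> lc wein gauss eqa conu [eigen slam] Up dp l0 Zi.
have oD := open_delta lc wein gauss eqa conu.
have [eigp lam01] := eigen p Up dp.
(* The other label supplies the second eigenvector [w]. *)
have [j lamji] : exists j, lam j p != lam i p.
  have [->|i0] := eqVneq i 0; first by exists 1; rewrite eq_sym.
  exists 0; suff -> : i = 1 by [].
  by case: (unliftP 0 i) i0 => [k|] -> //; rewrite (ord1 k) => _; exact: val_inj.
have /eigenvalueP[e eS e0] := eigp i; have /eigenvalueP[w wS w0] := eigp j.
have dl : differentiable (lam i) p by exact: smooth_diff (slam i) (conj Up dp).
have near_eigen : \forall q \near p, U q /\
    exists2 X : 'rV[R]_2, X != 0 & X *m S q = lam i q *: X.
  apply: (near_open oD (conj Up dp)) => q [Uq dq]; split=> //.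
  by have [/(_ i)/eigenvalueP[X XS X0] _] := eigen q Uq dq; exists X.
have A2 := A2_support_principal lc wein gauss eqa conu Up dl l0 near_eigen
  e0 w0 eS wS lamji.
have imm := immersion_focal_principal lc wein eqa Up dl l0 e0 w0 eS wS lamji.
split=> [/A2/imm I [_ _ _ nI]|nr]; first exact: nI.
by apply/A2/imm; apply: contrapT => nI; apply: nr; split.
Qed.
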